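(* Let $q>0$ be real and $r\in\mathbb{R}\setminus\{0\}$. For the quantum Euclidean spheres $S^{N-1}_q$ (algebras defined in the context), with $N=2n$ or $N=2n+1$, a projection $e\in\mathrm{Mat}_{2^n}(S^{N-1}_q)$ can be chosen so that the relations $e^2=e=e^*$ are equivalent to the defining relations of the algebra $S^{N-1}_q$. Explicitly, for $N=3,4,5,6$, write $a=(1+q)^{1/2}$ and regard the $x_i$ as generators of a unital complex $*$-algebra, with $x_0^*=x_0$ when $N$ is odd. Each matrix $e$ below is hermitian by construction, and it is idempotent, $e^2=e$, if and only if all the relations listed with it, which define $S^{N-1}_q$, are satisfied. **$N=3$** (generators $x_0,x_1$; arbitrary radius $r$): $$e=\tfrac12\begin{pmatrix}1+q^{-1/2}r^{-1}x_0& a\,r^{-1}x_1\\ a\,r^{-1}x_1^*&1-q^{1/2}r^{-1}x_0\end{pmatrix}.$$ Relations: $x_0x_1=qx_1x_0$, $x_1^*x_0=qx_0x_1^*$, $[x_1,x_1^*]=(1-q^{-1})x_0^2$, and $$r^2=qx_0^2+(1+q)x_1^*x_1=q^{-1}x_0^2+(1+q)x_1x_1^*.$$ **$N=5$** (generators $x_0,x_1,x_2$; radius normalized by $r^2=(1+q^3)/(1+q)$): $$e=\tfrac12\begin{pmatrix}1+q^{-3/2}x_0&q^{-1}a x_1&a x_2&0\\ q^{-1}a x_1^*&1-q^{-1/2}x_0&0&a x_2\\ a x_2^*&0&1-q^{-1/2}x_0&-a x_1\\ 0&a x_2^*&-a x_1^*&1+q^{1/2}x_0\end{pmatrix}.$$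 Relations: $x_ix_j=qx_jx_i$ for $i<j$; $x_i^*x_j=qx_jx_i^*$ for $i\ne j$; $[x_1,x_1^*]=(1-q^{-1})x_0^2$; $[x_2,x_2^*]=q^{-1}(1-q^{-1})(qx_1x_1^*+x_0^2+x_1^*x_1)$; and $$1=(1+q)x_2^*x_2+(1+q)x_1^*x_1+qx_0^2=(1+q)x_2x_2^*+q^{-2}\bigl[(1+q)x_1x_1^*+q^{-1}x_0^2\bigr].$$ **$N=4$** (generators $x_1,x_2$; radius normalized by $r^2=1+q^2$): $$e=\tfrac12\begin{pmatrix}1&q^{-1}x_1&x_2&0\\ q^{-1}x_1^*&1&0&x_2\\ x_2^*&0&1&-x_1\\ 0&x_2^*&-x_1^*&1\end{pmatrix}.$$ Relations: $x_ix_j=qx_jx_i$ for $i<j$; $x_i^*x_j=qx_jx_i^*$ for $i\ne j$; $[x_1,x_1^*]=0$; $[x_2,x_2^*]=(1-q^{-2})x_1x_1^*$; and $$1=x_2^*x_2+x_1^*x_1=x_2x_2^*+q^{-2}x_1x_1^*.$$ **$N=6$** (generators $x_1,x_2,x_3$; radius normalized by $r^2=1+q^4$): $$e=\tfrac12\begin{pmatrix}1&q^{-2}x_1&q^{-1}x_2&0&x_3&0&0&0\\ q^{-2}x_1^*&1&0&q^{-1}x_2&0&x_3&0&0\\ q^{-1}x_2^*&0&1&-q^{-1}x_1&0&0&x_3&0\\ 0&q^{-1}x_2^*&-q^{-1}x_1^*&1&0&0&0&x_3\\ x_3^*&0&0&0&1&-q^{-1}x_1&-x_2&0\\ 0&x_3^*&0&0&-q^{-1}x_1^*&1&0&-x_2\\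 0&0&x_3^*&0&-x_2^*&0&1&x_1\\ 0&0&0&x_3^*&0&-x_2^*&x_1^*&1\end{pmatrix}.$$ Relations: $x_ix_j=qx_jx_i$ for $i<j$; $x_i^*x_j=qx_jx_i^*$ for $i\ne j$; $[x_1,x_1^*]=0$; $[x_2,x_2^*]=(1-q^{-2})x_1x_1^*$; $[x_3,x_3^*]=(1-q^{-2})(x_2^*x_2+x_1^*x_1)=(1-q^{-2})(x_2x_2^*+q^{-2}x_1x_1^* )$; and $$1=x_3^*x_3+x_2^*x_2+x_1^*x_1=x_3x_3^*+q^{-2}(x_2x_2^*+q^{-2}x_1x_1^* ).$$ For a generic radius $r$, the idempotent for $N=4,5,6$ is obtained by multiplying the generators in the matrix by $(1+q^2)^{1/2}r^{-1}$, $[(1+q^3)/(1+q)]^{1/2}r^{-1}$, $(1+q^4)^{1/2}r^{-1}$ respectively. Moreover, writing $e_{(N-1)}$ for the matrix belonging to $S^{N-1}_q$ and $u_{(N-1)}=2e_{(N-1)}-1$ (with the factor $r^{-1}$ omitted in $u_{(2)}$), $$e_{(4)}=\tfrac12\begin{pmatrix}\mathbb{I}_2+q^{-1}u_{(2)}&a\,x_2\mathbb{I}_2\\ a\,x_2^*\mathbb{I}_2&\mathbb{I}_2-u_{(2)}\end{pmatrix},\qquad e_{(5)}=\tfrac12\begin{pmatrix}\mathbb{I}_4+q^{-1}u_{(3)}&x_3\mathbb{I}_4\\ x_3^*\mathbb{I}_4&\mathbb{I}_4-u_{(3)}\end{pmatrix},$$ and by applying this inductive construction one can obtain the projections for the higher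 dimensional even and odd spheres.
   Context: For $N=2n+1$ the generators are $x_0=x_0^*,x_1,\dots,x_n$ and their adjoints, and $\rho_i=\tfrac12-i$ for $1\le i\le n$. For $N=2n$ the generators are $x_1,\dots,x_n$ and their adjoints, and $\rho_i=1-i$. Set $$r_i^2=\sum_{k=1}^{i}\bigl(q^{-2\rho_k}x_kx_k^*+x_k^*x_k\bigr)+x_0^2,$$ where the $x_0^2$ term is absent if $N=2n$ (so $r_0^2=x_0^2$ for $N=2n+1$). The algebra of the quantum Euclidean space $\mathbb{R}^N_q$ is the unital complex $*$-algebra with these generators and the relations: $x_ix_j=q\,x_jx_i$ for $i<j$; $x_i^*x_j=q\,x_jx_i^*$ for $i\ne j$; $[x_1,x_1^*]=(1-q^{-1})x_0^2$ if $N=2n+1$, and $[x_1,x_1^*]=0$ if $N=2n$; $[x_i,x_i^*]=\frac{1-q^{-2}}{1+q^{-2\rho_{i-1}}}\,r_{i-1}^2$ for $i>1$. The element $r_n^2$ is central. The quantum Euclidean sphere $S^{N-1}_q$ of radius $r$ is the quotient obtained by imposing $r_n^2=r^2\cdot1$. A projection is a matrix $e$ with $e^2=e=e^*$, where $(e^* )_{ij}=(e_{ji})^*$; $\mathbb{I}_k$ is the $k\times k$ identity matrix. *)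

(* Defs.v *)
From HB Require Import structures.
From mathcomp Require Import all_boot all_order all_algebra.
From mathcomp Require Import generic_quotient boolp classical_sets reals exp.
From mathcomp Require Import finmap complex monalg.

Set Implicit Arguments.
Unset Strict Implicit.
Unset Printing Implicit Defensive.

Import Order.TTheory GRing.Theory Num.Theory.

Local Open Scope ring_scope.

HB.mixin Record isStarAlgebra (C : numClosedFieldType) A
    of GRing.Algebra C A := {
  star : A -> A;
  starK : involutive star;
  starD : {morph star : a b / a + b};
  starM : forall a b : A, star (a * b) = star b * star a;
  starZ : forall (c : C) (a : A), star (c *: a) = c^* *: star a
}.

#[short(type="starAlgType")]
HB.structure Definition StarAlgebra (C : numClosedFieldType) :=
  {A of GRing.Algebra C A & isStarAlgebra C A}.

(* star_quot below is the quotient of A by the two-sided *-ideal generated by *)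
(* the differences a - b with rel a b.                                        *)
Section StarQuotient.
Variables (C : numClosedFieldType) (A : starAlgType C).
Local Open Scope quotient_scope.

Definition is_star_ideal (I : set A) : Prop :=
  [/\ I 0, forall a b, I a -> I b -> I (a + b),
      forall a b c, I b -> I (a * b * c) & forall a, I a -> I (star a)].

Definition star_ideal (rel : A -> A -> Prop) : set A :=
  [set a | forall I : set A, is_star_ideal I ->
           (forall b c, rel b c -> I (b - c)) -> I a]%classic.

Variable rel : A -> A -> Prop.

Lemma star_idealP : is_star_ideal (star_ideal rel).
Proof.
split=> [I [] // | a b Ia Ib I hI hr | a b c Ib I hI hr | a Ia I hI hr].
- by case: (hI) => _ hD _ _; apply: hD; [apply: Ia | apply: Ib].
- by case: (hI) => _ _ hM _; apply: hM; apply: Ib.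
- by case: (hI) => _ _ _ hS; apply: hS; apply: Ia.
Qed.

Let I0 : star_ideal rel 0. Proof. by case: star_idealP. Qed.
Let ID a b : star_ideal rel a -> star_ideal rel b -> star_ideal rel (a + b).
Proof. by case: star_idealP => _ h _ _; apply: h. Qed.
Let IMM a b c : star_ideal rel b -> star_ideal rel (a * b * c).
Proof. by case: star_idealP => _ _ h _; apply: h. Qed.
Let IS a : star_ideal rel a -> star_ideal rel (star a).
Proof. by case: star_idealP => _ _ _ h; apply: h. Qed.
Let IMl a b : star_ideal rel b -> star_ideal rel (a * b).
Proof. by move=> h; rewrite -[a * b]mulr1; apply: IMM. Qed.
Let IMr a b : star_ideal rel a -> star_ideal rel (a * b).
Proof. by move=> h; rewrite -[a]mul1r; apply: IMM. Qed.
Let IN a : star_ideal rel a -> star_ideal rel (- a).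
Proof. by rewrite -mulN1r; apply: IMl. Qed.
Let IZ c a : star_ideal rel a -> star_ideal rel (c *: a).
Proof. by rewrite -[a in c *: a]mul1r scalerAl; apply: IMl. Qed.

Lemma star0 : star 0 = 0 :> A.
Proof. by apply: (addrI (star 0)); rewrite -starD !addr0. Qed.
Lemma starN (a : A) : star (- a) = - star a.
Proof. by apply: (addrI (star a)); rewrite -starD !subrr star0. Qed.
Lemma starB (a b : A) : star (a - b) = star a - star b.
Proof. by rewrite starD starN. Qed.

Definition star_quot_rel (a b : A) : bool := `[< star_ideal rel (a - b) >].

Lemma star_quot_rel_equiv : equiv_class_of star_quot_rel.
Proof.
split=> [a | a b | b a c].
- by apply/asboolP; rewrite subrr.
- by apply/asboolP/asboolP => h; rewrite -opprB; apply: IN.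
- move=> /asboolP h1 /asboolP h2; apply/asboolP.
  by rewrite -(subrKA b); apply: ID.
Qed.

Canonical star_quot_equiv := EquivRelPack star_quot_rel_equiv.
Canonical star_quot_encModRel := defaultEncModRel star_quot_rel.

(* Algebras over C are nonzero in this library, so the ideal must be proper. *)
Definition star_quot of ~ star_ideal rel 1 : Type := {eq_quot star_quot_rel}.

Variable rel_proper : ~ star_ideal rel 1.
Local Notation SQ := (star_quot rel_proper).

HB.instance Definition _ := Choice.on SQ.
HB.instance Definition _ := EqQuotient.on SQ.

Definition star_pi (a : A) : SQ := \pi_SQ a.

Lemma star_piP a b : star_pi a = star_pi b <-> star_ideal rel (a - b).
Proof.
split=> [/eqmodP /= /asboolP // | h].
by apply/eqmodP; apply/asboolP.
Qed.

Lemma star_piW (P : SQ -> Prop) : (forall a, P (star_pi a)) -> forall u, P u.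
Proof. by move=> h u; rewrite -[u]reprK; apply: h. Qed.

Lemma repr_star_pi a : star_ideal rel (repr (star_pi a) - a).
Proof. by apply/star_piP; rewrite /star_pi reprK. Qed.

Let qadd (u v : SQ) := star_pi (repr u + repr v).
Let qopp (u : SQ) := star_pi (- repr u).
Let qmul (u v : SQ) := star_pi (repr u * repr v).
Let qscale (c : C) (u : SQ) := star_pi (c *: repr u).
Let qstar (u : SQ) := star_pi (star (repr u)).

Let qaddE a b : qadd (star_pi a) (star_pi b) = star_pi (a + b).
Proof. by apply/star_piP; rewrite opprD addrACA; apply: ID; apply: repr_star_pi. Qed.
Let qoppE a : qopp (star_pi a) = star_pi (- a).
Proof. by apply/star_piP; rewrite -opprD; apply: IN; apply: repr_star_pi. Qed.
Let qmulE a b : qmul (star_pi a) (star_pi b) = star_pi (a * b).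
Proof.
apply/star_piP; set a' := repr _; set b' := repr _.
rewrite -(subrKA (a' * b)) -mulrBr -mulrBl.
by apply: ID; [apply: IMl | apply: IMr]; apply: repr_star_pi.
Qed.
Let qscaleE c a : qscale c (star_pi a) = star_pi (c *: a).
Proof. by apply/star_piP; rewrite -scalerBr; apply: IZ; apply: repr_star_pi. Qed.
Let qstarE a : qstar (star_pi a) = star_pi (star a).
Proof. by apply/star_piP; rewrite -starB; apply: IS; apply: repr_star_pi. Qed.

Fact qaddA : associative qadd.
Proof.
elim/star_piW=> a; elim/star_piW=> b; elim/star_piW=> c.
by rewrite !qaddE addrA.
Qed.
Fact qaddC : commutative qadd.
Proof. by elim/star_piW=> a; elim/star_piW=> b; rewrite !qaddE addrC. Qed.
Fact qadd0 : left_id (star_pi 0) qadd.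
Proof. by elim/star_piW=> a; rewrite qaddE add0r. Qed.
Fact qaddN : left_inverse (star_pi 0) qopp qadd.
Proof. by elim/star_piW=> a; rewrite qoppE qaddE addNr. Qed.
HB.instance Definition _ :=
  GRing.isZmodule.Build SQ qaddA qaddC qadd0 qaddN.

Fact qmulA : associative qmul.
Proof.
elim/star_piW=> a; elim/star_piW=> b; elim/star_piW=> c.
by rewrite !qmulE mulrA.
Qed.
Fact qmul1l : left_id (star_pi 1) qmul.
Proof. by elim/star_piW=> a; rewrite qmulE mul1r. Qed.
Fact qmul1r : right_id (star_pi 1) qmul.
Proof. by elim/star_piW=> a; rewrite qmulE mulr1. Qed.
Fact qmulDl : left_distributive qmul +%R.
Proof.
elim/star_piW=> a; elim/star_piW=> b; elim/star_piW=> c.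
by rewrite [_ + _]qaddE !qmulE [RHS]qaddE mulrDl.
Qed.
Fact qmulDr : right_distributive qmul +%R.
Proof.
elim/star_piW=> a; elim/star_piW=> b; elim/star_piW=> c.
by rewrite [_ + _]qaddE !qmulE [RHS]qaddE mulrDr.
Qed.
Fact qone_neq0 : star_pi 1 != 0.
Proof. by apply/eqP => /star_piP; rewrite subr0. Qed.
HB.instance Definition _ := GRing.Zmodule_isNzRing.Build SQ
  qmulA qmul1l qmul1r qmulDl qmulDr qone_neq0.

Fact qscaleA c d u : qscale c (qscale d u) = qscale (c * d) u.
Proof. by elim/star_piW: u => a; rewrite !qscaleE scalerA. Qed.
Fact qscale1 : left_id 1 qscale.
Proof. by elim/star_piW=> a; rewrite qscaleE scale1r. Qed.
Fact qscaleDr : right_distributive qscale +%R.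
Proof.
move=> c; elim/star_piW=> a; elim/star_piW=> b.
by rewrite [_ + _]qaddE !qscaleE [RHS]qaddE scalerDr.
Qed.
Fact qscaleDl u : {morph qscale^~ u : c d / c + d}.
Proof.
by move=> c d; elim/star_piW: u => a; rewrite !qscaleE [RHS]qaddE scalerDl.
Qed.
HB.instance Definition _ :=
  GRing.Zmodule_isLmodule.Build C SQ qscaleA qscale1 qscaleDr qscaleDl.

Fact qscaleAl c u v : qscale c (qmul u v) = qmul (qscale c u) v.
Proof.
elim/star_piW: u => a; elim/star_piW: v => b.
by rewrite !(qmulE, qscaleE) scalerAl.
Qed.
Fact qscaleAr c u v : qscale c (qmul u v) = qmul u (qscale c v).
Proof.
elim/star_piW: u => a; elim/star_piW: v => b.
by rewrite !(qmulE, qscaleE) scalerAr.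
Qed.
Fact qstarK : involutive qstar.
Proof. by elim/star_piW=> a; rewrite !qstarE starK. Qed.
Fact qstarD : {morph qstar : u v / qadd u v}.
Proof.
elim/star_piW=> a; elim/star_piW=> b.
by rewrite !(qaddE, qstarE) starD.
Qed.
Fact qstarM u v : qstar (qmul u v) = qmul (qstar v) (qstar u).
Proof.
elim/star_piW: u => a; elim/star_piW: v => b.
by rewrite !(qmulE, qstarE) starM.
Qed.
Fact qstarZ c u : qstar (qscale c u) = qscale c^* (qstar u).
Proof. by elim/star_piW: u => a; rewrite !(qscaleE, qstarE) starZ. Qed.
HB.instance Definition _ := GRing.Lmodule_isLalgebra.Build C SQ qscaleAl.
HB.instance Definition _ := GRing.Lalgebra_isAlgebra.Build C SQ qscaleAr.
HB.instance Definition _ := isStarAlgebra.Build C SQ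
  qstarK qstarD qstarM qstarZ.

Lemma star_piD a b : star_pi (a + b) = star_pi a + star_pi b.
Proof. by rewrite -[LHS]qaddE. Qed.
Lemma star_piN a : star_pi (- a) = - star_pi a.
Proof. by rewrite -[LHS]qoppE. Qed.
Lemma star_piM a b : star_pi (a * b) = star_pi a * star_pi b.
Proof. by rewrite -[LHS]qmulE. Qed.
Lemma star_pi1 : star_pi 1 = 1.
Proof. by []. Qed.
Lemma star_pi0 : star_pi 0 = 0.
Proof. by []. Qed.
Lemma star_piZ c a : star_pi (c *: a) = c *: star_pi a.
Proof. by rewrite -[LHS]qscaleE. Qed.
Lemma star_piS a : star_pi (star a) = star (star_pi a).
Proof. by rewrite -[LHS]qstarE. Qed.

End StarQuotient.

(* Letters of the free *-algebra on x_0 = x_0^* (only if b), x_1, ..., x_n:   *)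
(* [inl _] is x_0, [inr (i, false)] is x_(i+1) and [inr (i, true)] is its     *)
(* adjoint; the boolean b is coerced to a natural number in ['I_b].           *)
Definition letter (b : bool) (n : nat) : Type := ('I_b + 'I_n * bool)%type.
HB.instance Definition _ b n := Finite.on (letter b n).

Definition letter_star b n (l : letter b n) : letter b n :=
  match l with inl o => inl o | inr (i, s) => inr (i, ~~ s) end.

Section FreeStar.
Variables (R : realType) (b : bool) (n : nat).
Implicit Types w : {fmonom letter b n}.

Definition free_star : Type := {malg R[i][{fmonom letter b n}]}.
HB.instance Definition _ := GRing.Lalgebra.on free_star.

Definition word_star w : {fmonom letter b n} :=
  FMonom (rev (map (@letter_star b n) w)).

Definition free_star_star (g : free_star) : free_star :=
  \sum_(w <- msupp g) << (g@_w)^* *g word_star w >>.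

Lemma letter_starK : involutive (@letter_star b n).
Proof. by case=> [//|[i s]] /=; rewrite negbK. Qed.

Lemma word_starK : involutive word_star.
Proof.
move=> w; apply: val_inj => /=.
by rewrite map_rev revK -map_comp (eq_map letter_starK) map_id.
Qed.

Lemma word_starM v w : word_star (mmul v w) = mmul (word_star w) (word_star v).
Proof. by apply: val_inj; rewrite /= !fmM /= map_cat rev_cat. Qed.

Lemma free_star_coef g w : (free_star_star g)@_w = (g@_(word_star w))^*.
Proof.
rewrite /free_star_star raddf_sum /=.
have [wg|wg] := boolP (word_star w \in msupp g).
  rewrite (big_fsetD1 (word_star w)) //= mcoeffU word_starK eqxx mulr1n.
  rewrite big1_fset ?addr0 // => v; rewrite in_fsetD1 => /andP[vw _] _.
  by rewrite mcoeffU (can2_eq word_starK word_starK) (negPf vw).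
rewrite (mcoeff_outdom wg) conjC0 big1_fset // => v vg _.
rewrite mcoeffU (can2_eq word_starK word_starK).
by case: eqP => // e; rewrite -e vg in wg.
Qed.

Fact fscaleAr c (f g : free_star) : c *: (f * g) = f * (c *: g).
Proof.
apply/malgP => w; rewrite mcoeffZ.
have sfg := @mcoeffMlw _ _ (msupp f) (msupp g) f g w (fsubset_refl _) (fsubset_refl _).
have sfcg := @mcoeffMlw _ _ (msupp f) (msupp g) f (c *: g) w (fsubset_refl _) (msuppZ_le c g).
rewrite [X in c * X]sfg [RHS]sfcg mulr_sumr.
apply: eq_bigr => u _; rewrite mulr_sumr; apply: eq_bigr => v _.
by rewrite mcoeffZ mulrnAr mulrCA.
Qed.
HB.instance Definition _ := GRing.Lalgebra_isAlgebra.Build R[i] free_star fscaleAr.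

Fact fstarK : involutive free_star_star.
Proof. by move=> g; apply/malgP => w; rewrite !free_star_coef word_starK conjCK. Qed.
Fact fstarD : {morph free_star_star : f g / f + g}.
Proof.
by move=> f g; apply/malgP => w; rewrite free_star_coef !mcoeffD !free_star_coef rmorphD.
Qed.
Fact fstarZ c g : free_star_star (c *: g) = c^* *: free_star_star g.
Proof.
by apply/malgP => w; rewrite free_star_coef !mcoeffZ free_star_coef rmorphM.
Qed.
Fact fstarU c w : free_star_star << c *g w >> = << c^* *g word_star w >>.
Proof.
apply/malgP => v; rewrite free_star_coef !mcoeffU rmorphMn.
by rewrite (can2_eq word_starK word_starK) eq_sym.
Qed.
Fact fstar0 : free_star_star 0 = 0.
Proof. by rewrite /free_star_star msupp0 big_seq_fset0. Qed.
Fact fstarM f g :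
  free_star_star (f * g) = free_star_star g * free_star_star f.
Proof.
have sumE := big_morph free_star_star fstarD fstar0.
rewrite malgME sumE [free_star_star g]/free_star_star mulr_suml.
under eq_bigr do rewrite sumE.
rewrite exchange_big; apply: eq_bigr => v _ /=.
rewrite [free_star_star f]/free_star_star mulr_sumr; apply: eq_bigr => w _.
by rewrite fstarU malgM_def fgmulUU rmorphM mulrC word_starM.
Qed.
HB.instance Definition _ := isStarAlgebra.Build R[i] free_star
  fstarK fstarD fstarM fstarZ.

End FreeStar.

(* Out of range, and at i = 0 when b is false, the value is 0. *)
Definition free_gen (R : realType) b n (i : nat) : free_star R b n :=
  if i is j.+1 then
    if insub j is Some k then << fmu (inr (k, false)) >> else 0
  else if insub 0%N is Some o then << fmu (inl o) >> else 0.

Definition rscale (R : realType) (A : lmodType R[i]) (c : R) (a : A) : A :=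
  (real_complex R c) *: a.
Notation "c *:r a" := (rscale c a) (at level 40, left associativity) : ring_scope.

Definition commutator (A : pzRingType) (a b : A) : A := a * b - b * a.

(* N = 2 n + b, so b is the parity of N.  A family of generators is a         *)
(* function x : nat -> A, of which only x_0 (if b), x_1, ..., x_n are used.   *)
Section Sphere.
Variables (R : realType) (b : bool) (n : nat) (q r : R).

Definition rho (i : nat) : R := if b then 1/2 - i%:R else 1 - i%:R.

Section Relations.
Variables (A : starAlgType R[i]) (x : nat -> A).

Definition radius2 (i : nat) : A :=
  \sum_(1 <= k < i.+1)
    (q `^ (- 2 * rho k) *:r (x k * star (x k)) + star (x k) * x k)
  + (if b then x 0%N ^+ 2 else 0).

Definition is_index (i : nat) : bool := (~~ b <= i <= n)%N.

Inductive sphere_rel : A -> A -> Prop :=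
| Sphere_xx i j of is_index i & is_index j & (i < j)%N :
    sphere_rel (x i * x j) (q *:r (x j * x i))
| Sphere_sx i j of is_index i & is_index j & i != j :
    sphere_rel (star (x i) * x j) (q *:r (x j * star (x i)))
| Sphere_comm1 :
    sphere_rel (commutator (x 1%N) (star (x 1%N)))
               (if b then (1 - q^-1) *:r (x 0%N ^+ 2) else 0)
| Sphere_comm i of (1 < i <= n)%N :
    sphere_rel (commutator (x i) (star (x i)))
      (((1 - q ^- 2) / (1 + q `^ (- 2 * rho i.-1))) *:r radius2 i.-1)
| Sphere_radius :
    sphere_rel (radius2 n) ((r ^+ 2) *:r 1).

End Relations.

(* Evaluation of the relations under a character of an arbitrary algebra. *)
Section AbstractCharacter.
Variables (t : R) (A : starAlgType R[i]) (x : nat -> A) (chi : A -> R[i]).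
Hypothesis n_gt0 : (0 < n)%N.
Hypothesis tE : (1 + q `^ (- 2 * rho n)) * t ^+ 2 = r ^+ 2.
Hypotheses (chi0 : chi 0 = 0) (chi1 : chi 1 = 1).
Hypotheses (chiD : {morph chi : f g / f + g}) (chiB : {morph chi : f g / f - g}).
Hypothesis chiM : {morph chi : f g / f * g}.
Hypothesis chiZ : forall (c : R) g, chi (c *:r g) = real_complex R c * chi g.
Hypothesis chi_star : forall g, chi (star g) = (chi g)^*.
Hypothesis chi_gen : forall i, is_index i ->
  chi (x i) = if i == n then real_complex R t else 0.

Let char0 i : is_index i -> (i < n)%N -> chi (x i) = 0.
Proof. by move=> ii ltin; rewrite chi_gen // (ltn_eqF ltin). Qed.

Let char_x0 : chi (if b then x 0%N ^+ 2 else 0) = 0.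
Proof.
case: ifP => eb; last exact: chi0.
by rewrite expr2 chiM char0 ?mul0r // /is_index eb.
Qed.

Let index_gt0 k : (0 < k <= n)%N -> is_index k.
Proof. by move=> /andP[k0 kn]; rewrite /is_index kn andbT; case: (b). Qed.

Let char_radius i : (i < n)%N -> chi (radius2 x i) = 0.
Proof.
move=> ltin; rewrite chiD char_x0 addr0 (big_morph _ chiD chi0) big_nat big1 // => k /andP[k0 ki] /=.
have kn : (k < n)%N by apply: leq_trans ltin.
rewrite chiD.
rewrite chiZ.
rewrite chiM.
rewrite (chiM (star _)).
rewrite char0 //; last first.
  by apply: index_gt0; rewrite k0 ltnW.
by rewrite mul0r !mulr0 addr0.
Qed.

Let char_comm f g : chi (commutator f g) = 0.
Proof.
rewrite /commutator.
rewrite chiB.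
rewrite (chiM f).
rewrite (chiM g).
by rewrite mulrC subrr.
Qed.

Lemma chi_rel f g : sphere_rel x f g -> chi f = chi g.
Proof.
case=> [i j ii ij ltij|i j ii ij neij||i /andP[i1 lein]|].
- have ltin : (i < n)%N by apply: leq_trans ltij _; case/andP: ij.
  by rewrite chiM chiZ chiM (char0 ii ltin) mulr0 mul0r mulr0.
- rewrite chiM chiZ chiM chi_star !chi_gen //.
  have [ein|_] := eqVneq i n; last by rewrite conjC0 mulr0 mul0r mulr0.
  by rewrite -ein eq_sym (negPf neij) !(mul0r, mulr0).
- rewrite char_comm; case: ifP => eb; last by rewrite chi0.
  rewrite chiZ expr2 chiM char0 ?mulr0 ?mul0r ?mulr0 //.
  by rewrite /is_index eb.
- by rewrite char_comm chiZ char_radius ?mulr0 // prednK // ltnW.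
- rewrite chiZ chi1 mulr1 -tE.
  rewrite /radius2 big_nat_recr //=.
  have := @char_radius n.-1; rewrite /radius2 prednK // leqnn => /(_ isT).
  rewrite !chiD => e.
  rewrite addrAC e add0r chiZ (chiM (x n)) (chiM (star _)) chi_star.
  have nn : is_index n by apply: index_gt0; rewrite n_gt0 leqnn.
  rewrite chi_gen // eqxx conj_Creal; last first.
    by apply/complex_realP; exists t.
  by rewrite -!rmorphM -rmorphD /= mulrDl mul1r expr2 addrC.
Qed.

Lemma chi_ker_ideal : is_star_ideal [set g | chi g = 0]%classic.
Proof.
split=> /= [//|f g f0 g0|f g h' g0|f f0].
- by rewrite chiD f0 g0 addr0.
- by rewrite chiM (chiM f) g0 mulr0 mul0r.
- by rewrite chi_star f0 conjC0.
Qed.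

End AbstractCharacter.

(* A character of the sphere, showing that its ideal of relations is proper:  *)
(* x_n and x_n^* are sent to t, the other generators to 0.                    *)
Section Character.
Variable t : R.

Definition char_letter (l : letter b n) : R[i] :=
  if l is inr (k, _) then if k.+1 == n then real_complex R t else 0 else 0.
Definition char_word (w : {fmonom letter b n}) : R[i] :=
  \prod_(l <- (w : seq _)) char_letter l.

Fact char_word_mmorphism : mmorphism char_word.
Proof.
split=> [u v|]; rewrite /char_word; first by rewrite fmM big_cat.
by rewrite fm1 big_nil.
Qed.
HB.instance Definition _ :=
  monalg.isMultiplicative.Build _ _ char_word char_word_mmorphism.

Definition sphere_char (g : free_star R b n) : R[i] := mmap idfun char_word g.

Lemma char_letter_star l : char_letter (letter_star l) = char_letter l.
Proof. by case: l => [//|[k s]]. Qed.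

Lemma char_letter_conj l : (char_letter l)^* = char_letter l.
Proof.
case: l => [o|[k s]] /=; first by rewrite conjC0.
by case: ifP; rewrite ?conjC0 //= => _; apply/conj_Creal/complex_realP; exists t.
Qed.

Lemma sphere_char_star g : sphere_char (star g) = (sphere_char g)^*.
Proof.
rewrite [star g]/(free_star_star g) /free_star_star /sphere_char raddf_sum.
rewrite [in RHS]mmapE rmorph_sum; apply: eq_bigr => w _ /=.
rewrite mmapU rmorphM; congr (_ * _).
rewrite /char_word /= (perm_big (map (@letter_star b n) w)) ?perm_rev //=.
  rewrite big_map rmorph_prod; apply: eq_bigr => l _.
  by rewrite char_letter_star; apply: esym; apply: char_letter_conj.
Qed.

Lemma sphere_char_morph : [/\ sphere_char 0 = 0, sphere_char 1 = 1,
  {morph sphere_char : f g / f + g}, {morph sphere_char : f g / f - g} &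
  {morph sphere_char : f g / f * g}].
Proof.
by split; [exact: raddf0|exact: rmorph1|exact: raddfD|exact: raddfB|exact: rmorphM].
Qed.

Lemma sphere_charZ (c : R) g :
  sphere_char (c *:r g) = real_complex R c * sphere_char g.
Proof. exact: mmapZ. Qed.

Hypothesis n_gt0 : (0 < n)%N.

Lemma sphere_char_gen i : is_index i ->
  sphere_char (free_gen R b n i) = if i == n then real_complex R t else 0.
Proof.
case: i => [|i] /= /andP[_ lein].
  rewrite eq_sym (gtn_eqF n_gt0); case: insubP => [o _ _|_]; last exact: raddf0.
  by rewrite /sphere_char mmapU mul1r /char_word fmU big_seq1.
rewrite insubT /sphere_char mmapU mul1r /char_word fmU big_seq1 //=.
Qed.

End Character.



Lemma sphere_rel_proper : (0 < n)%N ->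
  ~ star_ideal (sphere_rel (free_gen R b n)) 1.
Proof.
move=> n_gt0.
pose p := 1 + q `^ (- 2 * rho n).
have p_gt0 : 0 < p by rewrite ltr_wpDr ?powR_ge0.
pose t := Num.sqrt (r ^+ 2 / p).
have tE : p * t ^+ 2 = r ^+ 2.
  rewrite sqr_sqrtr; last by rewrite divr_ge0 ?sqr_ge0 // ltW.
  by rewrite mulrCA divff ?mulr1 // gt_eqF.
pose F : starAlgType R[i] := free_star R b n.
pose chi : F -> R[i] := sphere_char t.
have [chi0 chi1 chiD chiB chiM] : [/\ chi 0 = 0, chi 1 = 1,
  {morph chi : f g / f + g}, {morph chi : f g / f - g} &
  {morph chi : f g / f * g}] by exact: sphere_char_morph.
have chiZ c g : chi (c *:r g) = real_complex R c * chi g by exact: sphere_charZ.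
have chi_star g : chi (star g) = (chi g)^* by exact: sphere_char_star.
have chi_gen := sphere_char_gen t n_gt0.
move=> /(_ [set g | chi g = 0]%classic) h.
suff: chi 1 = 0 by move/eqP; rewrite chi1 oner_eq0.
apply: h => [|f g fg]; last first.
  rewrite /= chiB (chi_rel n_gt0 tE chi0 chi1 chiD chiB chiM chiZ chi_star chi_gen fg).
  by rewrite subrr.
exact: chi_ker_ideal.
Qed.

(* The *-algebra S^(N-1)_q of radius r, and the images of its generators.     *)
Definition qsphere (n_gt0 : (0 < n)%N) : Type :=
  star_quot (sphere_rel_proper n_gt0).
HB.instance Definition _ n_gt0 := StarAlgebra.on (qsphere n_gt0).
Definition to_qsphere (n_gt0 : (0 < n)%N) : free_star R b n -> qsphere n_gt0 :=
  star_pi (sphere_rel_proper n_gt0).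
End Sphere.

Arguments rho {R} b i.
Arguments radius2 {R} b q {A} x i.
Arguments sphere_rel {R} b n q r {A} x _ _.
Arguments free_gen R b n i : clear implicits.
Arguments to_qsphere {R b n} q r n_gt0 _.

Definition rel_holds (A : Type) (rel : A -> A -> Prop) : Prop :=
  forall a c, rel a c -> a = c.

Definition mscale (R : realType) (A : lmodType R[i]) m n (c : R)
  (M : 'M[A]_(m, n)) : 'M[A]_(m, n) := map_mx (rscale c) M.
Notation "c *:m M" := (mscale c M) (at level 40, left associativity) : ring_scope.

Section Projection.
Variables (C : numClosedFieldType) (A : starAlgType C) (m : nat).
Implicit Type e : 'M[A]_m.

Definition star_mx e : 'M[A]_m := \matrix_(i, j) star (e j i).
Definition hermitian_mx e : Prop := star_mx e = e.
Definition idempotent_mx e : Prop := e *m e = e.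
Definition is_projection e : Prop := idempotent_mx e /\ hermitian_mx e.

Inductive projection_rel e : A -> A -> Prop :=
| Projection_idempotent i j : projection_rel e ((e *m e) i j) (e i j)
| Projection_hermitian i j : projection_rel e (star_mx e i j) (e i j).

Definition mx_of_rows (rows : seq (seq A)) : 'M[A]_m :=
  \matrix_(i < m, j < m) (nth [::] rows i)`_j.

End Projection.
Arguments mx_of_rows {C A} m rows.

(* [sphereK_mx] is e_(K), the matrix belonging to S^K_q, K = N - 1, and        *)
(* [sphereK_rels] is the list of relations attached to it.                     *)
Section Matrices.
Variables (R : realType) (q : R) (A : starAlgType R[i]) (x : nat -> A).

Local Notation h := (1 / 2 : R).
Local Notation a := ((1 + q) `^ (1 / 2)).
Local Notation x0 := (x 0%N).
Local Notation x1 := (x 1%N).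
Local Notation x2 := (x 2%N).
Local Notation x3 := (x 3%N).

Definition comm_rels (b : bool) (n : nat) : Prop :=
  (forall i j, is_index b n i -> is_index b n j -> (i < j)%N ->
     x i * x j = q *:r (x j * x i)) /\
  (forall i j, is_index b n i -> is_index b n j -> i != j ->
     star (x i) * x j = q *:r (x j * star (x i))).

Definition sphere2_mx (r : R) : 'M[A]_2 := h *:m mx_of_rows 2 [::
  [:: 1 + (q `^ (- (1 / 2)) * r^-1) *:r x0; (a * r^-1) *:r x1];
  [:: (a * r^-1) *:r star x1; 1 - (q `^ (1 / 2) * r^-1) *:r x0]].

Definition sphere2_rels (r : R) : Prop := [/\
  x0 * x1 = q *:r (x1 * x0),
  star x1 * x0 = q *:r (x0 * star x1),
  commutator x1 (star x1) = (1 - q^-1) *:r x0 ^+ 2,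
  (r ^+ 2) *:r 1 = q *:r x0 ^+ 2 + (1 + q) *:r (star x1 * x1) &
  (r ^+ 2) *:r 1 = q^-1 *:r x0 ^+ 2 + (1 + q) *:r (x1 * star x1)].

Definition sphere4_mx : 'M[A]_4 := h *:m mx_of_rows 4 [::
  [:: 1 + q `^ (- (3 / 2)) *:r x0; (q^-1 * a) *:r x1; a *:r x2; 0];
  [:: (q^-1 * a) *:r star x1; 1 - q `^ (- (1 / 2)) *:r x0; 0; a *:r x2];
  [:: a *:r star x2; 0; 1 - q `^ (- (1 / 2)) *:r x0; - (a *:r x1)];
  [:: 0; a *:r star x2; - (a *:r star x1); 1 + q `^ (1 / 2) *:r x0]].

Definition sphere4_rels : Prop := [/\
  comm_rels true 2,
  commutator x1 (star x1) = (1 - q^-1) *:r x0 ^+ 2,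
  commutator x2 (star x2) =
    (q^-1 * (1 - q^-1)) *:r (q *:r (x1 * star x1) + x0 ^+ 2 + star x1 * x1),
  1 = (1 + q) *:r (star x2 * x2) + (1 + q) *:r (star x1 * x1) + q *:r x0 ^+ 2 &
  1 = (1 + q) *:r (x2 * star x2)
      + q ^- 2 *:r ((1 + q) *:r (x1 * star x1) + q^-1 *:r x0 ^+ 2)].

Definition sphere3_mx : 'M[A]_4 := h *:m mx_of_rows 4 [::
  [:: 1; q^-1 *:r x1; x2; 0];
  [:: q^-1 *:r star x1; 1; 0; x2];
  [:: star x2; 0; 1; - x1];
  [:: 0; star x2; - star x1; 1]].

Definition sphere3_rels : Prop := [/\
  comm_rels false 2,
  commutator x1 (star x1) = 0,
  commutator x2 (star x2) = (1 - q ^- 2) *:r (x1 * star x1),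
  1 = star x2 * x2 + star x1 * x1 &
  1 = x2 * star x2 + q ^- 2 *:r (x1 * star x1)].

Definition sphere5_mx : 'M[A]_8 := h *:m mx_of_rows 8 [::
  [:: 1; q ^- 2 *:r x1; q^-1 *:r x2; 0; x3; 0; 0; 0];
  [:: q ^- 2 *:r star x1; 1; 0; q^-1 *:r x2; 0; x3; 0; 0];
  [:: q^-1 *:r star x2; 0; 1; - (q^-1 *:r x1); 0; 0; x3; 0];
  [:: 0; q^-1 *:r star x2; - (q^-1 *:r star x1); 1; 0; 0; 0; x3];
  [:: star x3; 0; 0; 0; 1; - (q^-1 *:r x1); - x2; 0];
  [:: 0; star x3; 0; 0; - (q^-1 *:r star x1); 1; 0; - x2];
  [:: 0; 0; star x3; 0; - star x2; 0; 1; x1];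
  [:: 0; 0; 0; star x3; 0; - star x2; star x1; 1]].

Definition sphere5_rels : Prop :=
  [/\ comm_rels false 3,
      commutator x1 (star x1) = 0 &
      commutator x2 (star x2) = (1 - q ^- 2) *:r (x1 * star x1)] /\
  [/\ commutator x3 (star x3) = (1 - q ^- 2) *:r (star x2 * x2 + star x1 * x1),
      commutator x3 (star x3)
        = (1 - q ^- 2) *:r (x2 * star x2 + q ^- 2 *:r (x1 * star x1)),
      1 = star x3 * x3 + star x2 * x2 + star x1 * x1 &
      1 = x3 * star x3
          + q ^- 2 *:r (x2 * star x2 + q ^- 2 *:r (x1 * star x1))].

Definition symmetry_of m (e : 'M[A]_m) : 'M[A]_m := 2 *:m e - 1%:M.

(* One step of the induction: u and x_n give 2 e - 1 in the next dimension. *)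
Definition suspension m (c : R) (u : 'M[A]_m) (y : A) : 'M[A]_(m + m) :=
  block_mx (q^-1 *:m u) (c *:r y)%:M (c *:r star y)%:M (- u).

Lemma pow2D n : (2 ^ n + 2 ^ n = 2 ^ n.+1)%N.
Proof. by rewrite expnS mul2n addnn. Qed.

(* The base case n = 0 is chosen so that the first step gives u_(2) with the  *)
(* factor r^-1 omitted (b = true), or ((0, x_1), (x_1^*, 0)) (b = false).     *)
Fixpoint sphere_u (b : bool) (n : nat) : 'M[A]_(2 ^ n) :=
  if n is m.+1 then
    castmx (pow2D m, pow2D m)
      (suspension (if b then a else 1) (sphere_u b m) (x m.+1))
  else (if b then q `^ (1 / 2) *:r x0 else 0)%:M.

Definition sphere_mx (b : bool) (n : nat) : 'M[A]_(2 ^ n) :=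
  h *:m (1%:M + sphere_u b n).

End Matrices.

(* The radius for which sphere_mx needs no rescaling of the generators. *)
Definition sphere_norm (R : realType) (q : R) (b : bool) (n : nat) : R :=
  ((1 + q `^ (- 2 * rho b n)) / (if b then 1 + q else 1)) `^ (1 / 2).

Definition rescale (R : realType) (A : lmodType R[i]) (c : R) (x : nat -> A)
  : nat -> A := fun i => c *:r x i.

(* Main.v *)
Require Import Defs.
From HB Require Import structures.
From mathcomp Require Import all_boot all_order all_algebra.
From mathcomp Require Import classical_sets reals exp complex.
From mathcomp Require Import boolp monalg ring lra.

(** With [c^2 = 1 + q] for odd N and [c = 1] for even N, put
    [u_n = ((q^-1 u_(n-1), c x_n), (c x_n^*, - u_(n-1)))], so that
    [e = (1 + u_n) / 2] is idempotent iff [u_n^2 = 1].  The off-diagonal blocks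
    of [u_n^2] vanish iff [x_n] and [x_n^*] q-commute with every entry of
    [u_(n-1)], that is with all earlier generators; the diagonal blocks are equal
    to the same scalar matrix [s] iff [u_(n-1)^2] is a scalar matrix [s'] with
    [s = s' + c^2 x_n^* x_n = q^-2 s' + c^2 x_n x_n^*].  By induction [u_n^2] is
    scalar iff the commutation relations hold and
    [c^2 [x_m, x_m^*] = (1 - q^-2) s_(m-1)] for all m, where
    [s_m = s_(m-1) + c^2 x_m^* x_m]; these relations force [s_m] to be the
    multiple [c^2 / (1 + q^(-2 rho_m))] of [r_m^2], which turns them into the
    relations of the sphere, and [s_n = 1] fixes the radius. *)

Set Implicit Arguments.
Unset Strict Implicit.
Unset Printing Implicit Defensive.

Import Order.TTheory GRing.Theory Num.Theory.

Local Open Scope ring_scope.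

(** * Scaling by real numbers *)

Section RealScaling.
Variable R : realType.

Section Lmodule.
Variable A : lmodType R[i].
Implicit Types (c d : R) (u v : A).

Lemma rscaleA c d u : c *:r (d *:r u) = (c * d) *:r u.
Proof. by rewrite /rscale scalerA -rmorphM. Qed.
Lemma rscale1 u : 1 *:r u = u.
Proof. by rewrite /rscale rmorph1 scale1r. Qed.
Lemma rscaler0 c : c *:r (0 : A) = 0.
Proof. exact: scaler0. Qed.
Lemma rscaleDr c u v : c *:r (u + v) = c *:r u + c *:r v.
Proof. exact: scalerDr. Qed.
Lemma rscaleBr c u v : c *:r (u - v) = c *:r u - c *:r v.
Proof. exact: scalerBr. Qed.
Lemma rscalerN c u : c *:r (- u) = - (c *:r u).
Proof. exact: scalerN. Qed.
Lemma rscaleNr c u : (- c) *:r u = - (c *:r u).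
Proof. by rewrite /rscale rmorphN scaleNr. Qed.
Lemma rscaleDl c d u : (c + d) *:r u = c *:r u + d *:r u.
Proof. by rewrite /rscale rmorphD scalerDl. Qed.
Lemma rscaleBl c d u : (c - d) *:r u = c *:r u - d *:r u.
Proof. by rewrite rscaleDl rscaleNr. Qed.
Lemma rscale_sum c I (s : seq I) (P : pred I) (F : I -> A) :
  c *:r (\sum_(i <- s | P i) F i) = \sum_(i <- s | P i) c *:r F i.
Proof. exact: scaler_sumr. Qed.
Lemma rscaleI c : c != 0 -> injective (@rscale R A c).
Proof.
by move=> c0 u v e; rewrite -[u]rscale1 -[v]rscale1 -(mulVf c0) -!rscaleA e.
Qed.

Lemma rscale_eq c u v : c != 0 -> (c *:r u = c *:r v) <-> (u = v).
Proof. by move=> c0; split=> [/(rscaleI c0)|->]. Qed.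

End Lmodule.

Section StarAlgebra.
Variable A : starAlgType R[i].
Implicit Types (c d : R) (x y : A).

Lemma rscaleAl c x y : (c *:r x) * y = c *:r (x * y).
Proof. by rewrite /rscale scalerAl. Qed.
Lemma rscaleAr c x y : x * (c *:r y) = c *:r (x * y).
Proof. by rewrite /rscale scalerAr. Qed.
Lemma star_rscale c x : star (c *:r x) = c *:r star x.
Proof.
rewrite /rscale starZ; congr (_ *: _).
by apply/conj_Creal/complex_realP; exists c.
Qed.
Lemma star1 : star 1 = 1 :> A.
Proof. by rewrite -[LHS]mulr1 -[X in _ * X = _]starK -starM mulr1 starK. Qed.
Lemma star_eq x y : star x = star y <-> x = y.
Proof. by split=> [/(inv_inj (@starK _ A))|->]. Qed.

Lemma mul_mx_scalarE m (u : 'M[A]_m) x i j : (u *m x%:M) i j = u i j * x.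
Proof.
rewrite mxE (bigD1 j) //= mxE eqxx big1 ?addr0 // => k kj.
by rewrite mxE (negPf kj) mulr0.
Qed.

Lemma mscale_mulmx m (u v : 'M[A]_m) c d :
  (c *:m u) *m (d *:m v) = (c * d) *:m (u *m v).
Proof.
apply/matrixP=> i j; rewrite !mxE rscale_sum; apply: eq_bigr => k _.
by rewrite !mxE rscaleAl rscaleAr rscaleA.
Qed.

Lemma mscale_mul_scalarE m (u : 'M[A]_m) c x i j :
  ((c *:m u) *m x%:M) i j = c *:r (u i j * x).
Proof. by rewrite mul_mx_scalarE mxE rscaleAl. Qed.

Lemma mscale_scalar m c x : c *:m (x%:M : 'M[A]_m) = (c *:r x)%:M.
Proof.
by apply/matrixP=> i j; rewrite !mxE; case: (_ == _); rewrite ?rscaler0.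
Qed.

Lemma scalar_mx_inj m : (0 < m)%N -> injective (fun x : A => (x%:M : 'M_m)).
Proof.
by case: m => // m _ x y /matrixP/(_ ord0 ord0); rewrite !mxE eqxx.
Qed.

End StarAlgebra.
End RealScaling.

(** * One inductive step *)

Section Suspension.
Variables (R : realType) (q : R) (A : starAlgType R[i]) (m : nat).
Hypotheses (q_gt0 : 0 < q) (m_gt0 : (0 < m)%N).
Implicit Types (u : 'M[A]_m) (s x y : A) (c : R).

Let q_neq0 : q != 0. Proof. by rewrite gt_eqF. Qed.

(** The four conditions come from the lower right, upper right, lower left and upper left blocks, in
    this order. The value of [u *m u] forced by the lower right block has been substituted into the
    upper left one, which leaves an equation between scalars. *)
Lemma suspension_sqr c u y s : c != 0 ->
  suspension q c u y *m suspension q c u y = s%:M <->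
  [/\ u *m u = (s - c ^+ 2 *:r (star y * y))%:M,
      forall i j, u i j * y = q *:r (y * u i j),
      forall i j, star y * u i j = q *:r (u i j * star y) &
      q ^- 2 *:r (s - c ^+ 2 *:r (star y * y)) + c ^+ 2 *:r (y * star y) = s].
Proof.
move=> c0; rewrite /suspension mulmx_block scalar_mx_block mscale_mulmx.
rewrite -!scalar_mxM !rscaleAl !rscaleAr !rscaleA.
rewrite [- u *m - u]mulNmx [u *m - u]mulmxN opprK.
rewrite -!expr2 exprVn.
(* Each entry of an off-diagonal block is [c * q^-1] times a q-commutator, so this factor can be
   cancelled. *)
have cq0 : c * q^-1 != 0 by rewrite mulf_neq0 ?invr_eq0.
have urE : (q^-1 *:m u) *m (c *:r y)%:M + (c *:r y)%:M *m (- u) = 0 <->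
    forall i j, u i j * y = q *:r (y * u i j).
  have Eij i j : ((q^-1 *:m u) *m (c *:r y)%:M + (c *:r y)%:M *m (- u)) i j
      = (c * q^-1) *:r (u i j * y - q *:r (y * u i j)).
    rewrite mxE mscale_mul_scalarE mul_scalar_mx !mxE mulrN rscaleAr rscaleAl.
    by rewrite rscaleBr !rscaleA -mulrA mulVf // mulr1 mulrC.
  split=> [/matrixP e i j|e]; last first.
    by apply/matrixP=> i j; rewrite Eij e subrr rscaler0 mxE.
  apply/eqP; rewrite -subr_eq0; apply/eqP.
  by apply: (rscaleI cq0); rewrite rscaler0 -Eij e mxE.
have dlE : (c *:r star y)%:M *m (q^-1 *:m u) + (- u) *m (c *:r star y)%:M = 0
    <-> forall i j, star y * u i j = q *:r (u i j * star y).
  have Eij i j :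
      ((c *:r star y)%:M *m (q^-1 *:m u) + (- u) *m (c *:r star y)%:M) i j
      = (c * q^-1) *:r (star y * u i j - q *:r (u i j * star y)).
    rewrite mxE mul_scalar_mx mul_mx_scalarE !mxE mulNr !rscaleAr !rscaleAl.
    by rewrite rscaleBr !rscaleA divfK // [q^-1 * c]mulrC.
  split=> [/matrixP e i j|e]; last first.
    by apply/matrixP=> i j; rewrite Eij e subrr rscaler0 mxE.
  apply/eqP; rewrite -subr_eq0; apply/eqP.
  by apply: (rscaleI cq0); rewrite rscaler0 -Eij e mxE.
have drE : (c ^+ 2 *:r (star y * y))%:M + u *m u = s%:M <->
    u *m u = (s - c ^+ 2 *:r (star y * y))%:M.
  rewrite raddfB /=; split=> [<-|->]; first by rewrite addrC addKr.
  by rewrite addrC subrK.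
split=> [/eq_block_mx[ul /urE ur /dlE dl /drE dr]|[uu /urE-> /dlE-> ul]].
  split=> //; apply: (scalar_mx_inj m_gt0).
  by rewrite -ul dr mscale_scalar -raddfD.
congr block_mx; last exact/drE.
by rewrite uu mscale_scalar -raddfD /= ul.
Qed.

Lemma suspension_herm c u y : hermitian_mx u -> hermitian_mx (suspension q c u y).
Proof.
move=> /matrixP hu; apply/matrixP=> i j.
rewrite /suspension mxE.
case: (split_ordP i) => i' ->; case: (split_ordP j) => j' ->.
all: rewrite ?(block_mxEul, block_mxEur, block_mxEdl, block_mxEdr).
- by have := hu i' j'; rewrite !mxE star_rscale => ->.
- rewrite !mxE eq_sym; case: (_ == _); rewrite ?mulr0n ?star0 // !mulr1n.
  by rewrite star_rscale starK.
- rewrite !mxE eq_sym; case: (_ == _); rewrite ?mulr0n ?star0 // !mulr1n.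
  by rewrite star_rscale.
- by have := hu i' j'; rewrite !mxE starN => ->.
Qed.

(** [P] will be q-commutation with a fixed element, which survives nonzero real factors. This turns
    a condition on all matrix entries into one on the generators. *)
Lemma suspension_entries (P : A -> Prop) c u y :
  c != 0 -> P 0 -> (forall (d : R) x, d != 0 -> P (d *:r x) <-> P x) ->
  (forall i j, P (suspension q c u y i j)) <->
  [/\ forall i j, P (u i j), P y & P (star y)].
Proof.
move=> c0 P0 PZ.
have PN x : P (- x) <-> P x.
  by rewrite -[x in - x]rscale1 -rscaleNr; apply: PZ; rewrite oppr_eq0 oner_eq0.
split=> [hP|[Pu Py Psy] i j].
  (* A diagonal position exists because [m] is positive; there the off-diagonal blocks contain [y]
     and [star y] up to the factor [c]. *)
  have o : 'I_m := Ordinal m_gt0.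
  split=> [i j||].
  - have := hP (rshift m i) (rshift m j).
    by rewrite block_mxEdr mxE => /PN.
  - have := hP (lshift m o) (rshift m o).
    by rewrite block_mxEur mxE eqxx => /PZ -/(_ c0).
  - have := hP (rshift m o) (lshift m o).
    by rewrite block_mxEdl mxE eqxx => /PZ -/(_ c0).
rewrite /suspension.
case: (split_ordP i) => i' ->; case: (split_ordP j) => j' ->.
all: rewrite ?(block_mxEul, block_mxEur, block_mxEdl, block_mxEdr) !mxE.
- by apply/PZ => //; rewrite invr_eq0.
- by case: (_ == _) => //; apply/PZ.
- by case: (_ == _) => //; apply/PZ.
- exact: (proj2 (PN _) (Pu _ _)).
Qed.

End Suspension.

Lemma castmx_entries T m m' (e : m = m') (M : 'M[T]_m) (P : T -> Prop) :
  (forall i j, P (castmx (e, e) M i j)) <-> (forall i j, P (M i j)).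
Proof. by case: m' / e; rewrite castmx_id. Qed.

(** * The square of the iterated suspension *)

Section Inductive.
Variables (R : realType) (q : R) (b : bool) (A : starAlgType R[i]) (x : nat -> A).
Hypothesis q_gt0 : 0 < q.

Local Notation a := ((1 + q) `^ (1 / 2)).
Local Notation coef := (if b then a else 1).
Local Notation coef2 := (if b then 1 + q else 1).
Local Notation u := (sphere_u q x b).

Lemma sqr_powR_half (z : R) : 0 < z -> (z `^ (1 / 2)) ^+ 2 = z.
Proof.
move=> z0; rewrite expr2 -powRD; last by rewrite (gt_eqF z0) implybT.
by rewrite -splitr powRr1 // ltW.
Qed.

Lemma coef2_gt0 : 0 < coef2.
Proof. by case: ifP => // _; rewrite addr_gt0. Qed.

Lemma sqr_coef : coef ^+ 2 = coef2.
Proof. by case: ifP => _; rewrite ?expr1n // sqr_powR_half // addr_gt0. Qed.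

Lemma coef_neq0 : coef != 0.
Proof. by rewrite -sqrf_eq0 sqr_coef gt_eqF // coef2_gt0. Qed.

(** This is the last diagonal entry of the square of [u n]. The lower right blocks carry no factor
    [q^-1], so only the products [star (x k) * x k] occur besides the square of [q^(1/2) x_0]. *)
Fixpoint sphere_sqr (n : nat) : A :=
  if n is m.+1 then sphere_sqr m + coef2 *:r (star (x m.+1) * x m.+1)
  else if b then q *:r x 0%N ^+ 2 else 0.

(** An intermediate form of the sphere relations, written with the partial squares in place of
    [radius2]. Each suspension adds exactly one commutator relation to it. *)
Definition clifford_rels (n : nat) (s : A) : Prop :=
  [/\ comm_rels q x b n,
      forall m, (m < n)%N -> coef2 *:r commutator (x m.+1) (star (x m.+1))
        = (1 - q ^- 2) *:r sphere_sqr m &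
      sphere_sqr n = s].

(** Up to nonzero real factors, the nonzero entries of [u n] are generators and their adjoints, and
    each of these occurs somewhere. *)
Lemma sphere_u_entries (P : A -> Prop) n :
  P 0 -> (forall (d : R) y, d != 0 -> P (d *:r y) <-> P y) ->
  (forall i j, P (u n i j)) <->
  (b -> P (x 0%N)) /\ (forall k, (0 < k <= n)%N -> P (x k) /\ P (star (x k))).
Proof.
move=> P0 PZ; elim: n => [|n IHn] /=.
  have sqrt_neq0 : q `^ (1 / 2) != 0 by rewrite gt_eqF // powR_gt0.
  split=> [/(_ ord0 ord0)|[hP _] i j].
    rewrite mxE eqxx; case: (b) => hP; last by split=> // -[].
    by split=> [_|[]//]; apply/(PZ _ _ sqrt_neq0).
  rewrite mxE; case: (_ == _) => //; rewrite mulr1n.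
  by move: hP; case: (b) => // hP; apply/(PZ _ _ sqrt_neq0)/hP.
rewrite castmx_entries (suspension_entries q_gt0 _ _ _ coef_neq0) ?expn_gt0 //.
split=> [[/IHn[hP0 hP] Py Psy]|[hP0 hP]].
  split=> // k /andP[k0]; rewrite leq_eqVlt => /predU1P[->//|kn].
  by apply: hP; rewrite k0.
have [Py Psy] : P (x n.+1) /\ P (star (x n.+1)) by apply: hP; rewrite leqnn.
split=> //; apply/IHn; split=> // k /andP[k0 kn]; apply: hP.
by rewrite k0 leqW.
Qed.

Hypothesis x0_star : b -> star (x 0%N) = x 0%N.

Lemma sphere_u_herm n : hermitian_mx (u n).
Proof.
elim: n => [|n IHn].
  apply/matrixP=> i j; rewrite !mxE eq_sym.
  case: (_ == _); rewrite ?mulr0n ?star0 // !mulr1n.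
  by move: x0_star; case: (b) => [e|_]; rewrite ?star0 // star_rscale e.
have := suspension_herm q coef (x n.+1) IHn.
by rewrite /=; case: _ / (pow2D n); rewrite castmx_id.
Qed.

(** The condition [i < j] leaves one new relation for each earlier index [k], while [i != j] leaves
    two, according to which factor carries the star. *)
Lemma comm_relsS n : comm_rels q x b n.+1 <-> comm_rels q x b n /\
  (forall k, is_index b n k ->
    [/\ x k * x n.+1 = q *:r (x n.+1 * x k),
        star (x k) * x n.+1 = q *:r (x n.+1 * star (x k)) &
        star (x n.+1) * x k = q *:r (x k * star (x n.+1))]).
Proof.
have idxW k : is_index b n k -> is_index b n.+1 k.
  by move=> /andP[k0 kn]; rewrite /is_index k0 leqW.
have idx_lt k : is_index b n k -> (k < n.+1)%N by move=> /andP[].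
have idxS : is_index b n.+1 n.+1 by rewrite /is_index leqnn; case: (b).
have idxP k : is_index b n.+1 k -> k = n.+1 \/ is_index b n k.
  move=> /andP[k0]; rewrite leq_eqVlt => /predU1P[->|kn]; first by left.
  by right; rewrite /is_index k0.
split=> [[xx sx]|[[xx sx] hk]].
  split=> [|k ik].
    by split=> i j /idxW ii /idxW ij; [apply: xx|apply: sx].
  have ltk := idx_lt k ik; have ik' := idxW k ik.
  by split; [apply: xx|apply: sx; rewrite // ltn_eqF|apply: sx; rewrite // gtn_eqF].
split=> i j /idxP[->|ii] /idxP[->|ij].
- by rewrite ltnn.
- by rewrite ltnNge ltnW // idx_lt.
- by move=> _; case: (hk i ii).
- exact: xx.
- by rewrite eqxx.
- by move=> _; case: (hk j ij).
- by move=> _; case: (hk i ii).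
- exact: sx.
Qed.

Lemma comm_rels0 : comm_rels q x b 0.
Proof.
by split=> i j /andP[_]; rewrite leqn0 => /eqP-> /andP[_];
  rewrite leqn0 => /eqP->.
Qed.

(* The four families of commutations come in two pairs of adjoint relations. *)
Lemma sphere_u_comm n y :
  (forall k, is_index b n k ->
    [/\ x k * y = q *:r (y * x k),
        star (x k) * y = q *:r (y * star (x k)) &
        star y * x k = q *:r (x k * star y)]) <->
  (forall i j, u n i j * y = q *:r (y * u n i j)) /\
  (forall i j, star y * u n i j = q *:r (u n i j * star y)).
Proof.
rewrite (sphere_u_entries (P := fun z => z * y = q *:r (y * z))); last first.
- by move=> d z d0; rewrite rscaleAl rscaleAr rscaleA mulrC -rscaleA rscale_eq.
- by rewrite mul0r mulr0 rscaler0.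
rewrite (sphere_u_entries (P := fun z => star y * z = q *:r (z * star y)));
  last first.
- by move=> d z d0; rewrite rscaleAl rscaleAr rscaleA mulrC -rscaleA rscale_eq.
- by rewrite mul0r mulr0 rscaler0.
have adj z : star y * z = q *:r (z * star y) <-> star z * y = q *:r (y * star z).
  by rewrite -star_eq star_rscale !starM starK.
split=> [h|[[h0 hk] [h0' hk']] k].
  have idx k : (0 < k <= n)%N -> is_index b n k.
    by move=> /andP[k0 kn]; rewrite /is_index kn andbT; case: (b).
  split; split=> [eb|k /idx/h[h1 h2 h3]]; rewrite ?adj ?starK //.
  - by case: (h 0%N) => //; rewrite /is_index eb.
  - by case: (h 0%N) => //; rewrite /is_index eb.
(* Index 0 occurs only for odd N, where [x 0] is self-adjoint, so its starred relation is the
   unstarred one. *)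
rewrite /is_index; case: k => [|k] /andP[eb kn].
  have {}eb : b by case: (b) eb.
  by rewrite x0_star //; split=> //; [exact: h0|exact: h0|exact: h0'].
by case: (hk k.+1 kn) => ? ?; case: (hk' k.+1 kn).
Qed.

(* The two diagonal blocks of the square of a suspension. *)
Lemma sphere_sqr_dual (S y s : A) : S + coef2 *:r (star y * y) = s ->
  q ^- 2 *:r S + coef2 *:r (y * star y) = s <->
  coef2 *:r commutator y (star y) = (1 - q ^- 2) *:r S.
Proof.
move=> <-; rewrite rscaleBr rscaleBl rscale1.
split=> [e|/eqP]; last first.
  by rewrite subr_eq => /eqP->; rewrite addrA addrCA subrr addr0.
by apply/eqP; rewrite subr_eq addrAC -e addrAC subrr add0r.
Qed.

(** The induction is over all [s], because the smaller matrix squares to the different scalar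
    [s - coef2 *:r (star y * y)] with [y = x n.+1]. *)
Lemma sphere_u_sqr n s : u n *m u n = s%:M <-> clifford_rels n s.
Proof.
elim: n s => [|n IHn] s /=.
  (* The base matrix is 1 by 1: its square is [q *:r x 0 ^+ 2] for odd N and 0 for even N. *)
  rewrite -scalar_mxM.
  split=> [/(scalar_mx_inj (m := 1) isT) <-|[_ _ /= <-]]; last first.
    by case: (b); rewrite ?mulr0 // rscaleAl rscaleAr rscaleA -!expr2
      sqr_powR_half.
  split=> //; first exact: comm_rels0.
  by rewrite /=; case: (b); rewrite ?mulr0 // rscaleAl rscaleAr rscaleA -!expr2
    sqr_powR_half.
have castE : castmx (pow2D n, pow2D n) (suspension q coef (u n) (x n.+1)) *m
    castmx (pow2D n, pow2D n) (suspension q coef (u n) (x n.+1)) = s%:M <->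
    suspension q coef (u n) (x n.+1) *m suspension q coef (u n) (x n.+1) = s%:M.
  by case: _ / (pow2D n); rewrite castmx_id.
rewrite castE (suspension_sqr q_gt0 _ _ _ _ coef_neq0) ?expn_gt0 // sqr_coef.
set y := x n.+1; set Q := star y * y.
split=> [[/IHn[xx comm sE] h1 h2 rad]|[/comm_relsS[xx /sphere_u_comm h] comm sE]].
  have sE' : sphere_sqr n + coef2 *:r Q = s by rewrite sE subrK.
  split=> //=; first by apply/comm_relsS; split=> //; apply/sphere_u_comm.
  move=> m; rewrite ltnS leq_eqVlt => /predU1P[->|/comm//].
  by apply/(sphere_sqr_dual sE'); rewrite sE.
have sE' : s - coef2 *:r Q = sphere_sqr n by rewrite -sE /= addrK.
case: h => h1 h2; rewrite sE'; split=> //.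
  by apply/IHn; split=> // m mn; apply: comm; rewrite leqW.
by apply/sphere_sqr_dual => //; apply: comm.
Qed.

End Inductive.

(** * The relations of the sphere *)

Section SphereRelations.
Variables (R : realType) (q : R) (b : bool).
Hypothesis q_gt0 : 0 < q.

Local Notation coef2 := (if b then 1 + q else 1).
Local Notation t k := (q `^ (- 2 * rho b k)).

Let q_neq0 : q != 0. Proof. by rewrite gt_eqF. Qed.

Lemma powR_rho_gt0 k : 0 < t k. Proof. exact: powR_gt0. Qed.

Lemma powR_rhoD1_gt0 k : 0 < 1 + t k.
Proof. by rewrite addr_gt0 // powR_rho_gt0. Qed.

Lemma powR_rhoS k : t k.+1 = q ^+ 2 * t k.
Proof.
have -> : - 2 * rho b k.+1 = 2%:R + - 2 * rho b k :> R.
  by rewrite /rho -natr1; case: (b); ring.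
by rewrite powRD ?(gt_eqF q_gt0) ?implybT // powR_mulrn // ltW.
Qed.

(** The sphere uses [rho] only from index 1 on. Extending it to 0 by the same formula makes the
    relation for the commutator of [x 1] and its adjoint the first case of the general commutator
    relation. *)
Lemma powR_rho0 : t 0 = if b then q^-1 else q ^- 2.
Proof.
rewrite /rho; case: (b).
  have -> : - 2 * (1 / 2 - 0%:R) = -1 :> R by field.
  by rewrite powR_inv1 // ltW.
have -> : - 2 * (1 - 0%:R) = - 2%:R :> R by ring.
by rewrite powRN powR_mulrn // ltW.
Qed.

Variable A : starAlgType R[i].

Section Generators.
Variable x : nat -> A.

Local Notation S := (sphere_sqr q b x).
Local Notation rad := (radius2 b q x).

Let coef2_neq0 : coef2 != 0. Proof. by rewrite gt_eqF // coef2_gt0. Qed.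

Lemma radius2S n : rad n.+1 =
  (t n.+1 *:r (x n.+1 * star (x n.+1)) + star (x n.+1) * x n.+1) + rad n.
Proof. by rewrite /radius2 big_nat_recr //= [X in X + _]addrC -addrA. Qed.

Lemma radius2_0 : rad 0 = if b then x 0%N ^+ 2 else 0.
Proof. by rewrite /radius2 big_geq // add0r. Qed.

(** By induction: the commutator relation removes [x n.+1 * star (x n.+1)] from the radius, after
    which both sides are combinations of [star (x n.+1) * x n.+1] and [S n]. *)
Lemma sphere_sqr_radius n :
  (forall m, (m < n)%N -> coef2 *:r commutator (x m.+1) (star (x m.+1))
    = (1 - q ^- 2) *:r S m) ->
  S n = (coef2 / (1 + t n)) *:r rad n.
Proof.
elim: n => [_|n IHn comm].
  rewrite radius2_0 powR_rho0 /=; case: (b); rewrite ?rscaler0 //.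
  congr (_ *:r _); field.
  by rewrite q_neq0 gt_eqF // addr_gt0.
have IH := IHn (fun m mn => comm m (leqW mn)).
have t1 := lt0r_neq0 (powR_rhoD1_gt0 n).
have q2t1 : 1 + q ^+ 2 * t n != 0 by rewrite -powR_rhoS lt0r_neq0 // powR_rhoD1_gt0.
have radE : rad n = ((1 + t n) / coef2) *:r S n.
  by rewrite IH rscaleA mulrA divfK // divff // rscale1.
have PE : x n.+1 * star (x n.+1) =
    star (x n.+1) * x n.+1 + ((1 - q ^- 2) / coef2) *:r S n.
  rewrite -[LHS](subrK (star (x n.+1) * x n.+1)) addrC; congr (_ + _).
  apply: (rscaleI coef2_neq0); apply: etrans (comm n (ltnSn n)) _.
  by rewrite rscaleA mulrCA divff ?mulr1.
(* With [t = t n], the coefficients match because [q^2 t (1 - q^-2) + (1 + t) = 1 + q^2 t]. *)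
rewrite radius2S /= PE radE powR_rhoS; set Q := star _ * _.
rewrite !rscaleDr !rscaleA [X in _ = X + _]addrAC -[RHS]addrA -!rscaleDl.
rewrite [RHS]addrC -[X in X + _ = _]rscale1.
by congr (_ + _); congr rscale; move: coef2_neq0 q2t1;
  move: coef2 (t n) => c T c0 T0; field; rewrite ?c0 ?T0 ?q_neq0.
Qed.

(** Replacing [S m] by a multiple of [rad m] requires the commutator relations below [m], so the two
    families are exchanged one index at a time. *)
Lemma comm_radius n :
  (forall m, (m < n)%N -> coef2 *:r commutator (x m.+1) (star (x m.+1))
    = (1 - q ^- 2) *:r S m) <->
  (forall m, (m < n)%N -> commutator (x m.+1) (star (x m.+1))
    = ((1 - q ^- 2) / (1 + t m)) *:r rad m).
Proof.
have step m : S m = (coef2 / (1 + t m)) *:r rad m ->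
    coef2 *:r commutator (x m.+1) (star (x m.+1)) = (1 - q ^- 2) *:r S m <->
    commutator (x m.+1) (star (x m.+1)) = ((1 - q ^- 2) / (1 + t m)) *:r rad m.
  move=> ->; rewrite rscaleA mulrCA -rscaleA.
  exact: rscale_eq.
elim: n => [//|n IHn]; split=> comm m; rewrite ltnS => mn.
  apply/step; last exact: comm.
  by apply: sphere_sqr_radius => k km; apply: comm; apply: leqW (leq_trans km mn).
apply/step; last exact: comm.
apply: sphere_sqr_radius => k km; apply: (proj2 IHn) => [l ln|].
  by apply: comm; apply: leqW.
exact: leq_trans km mn.
Qed.

(** Given the commutator relations, [S n] is the multiple [coef2 / (1 + t n)] of [rad n], so fixing
    the radius amounts to fixing [S n]. *)
Lemma sphere_relsE n r : (0 < n)%N ->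
  rel_holds (sphere_rel b n q r x) <->
  clifford_rels q b x n ((coef2 / (1 + t n) * r ^+ 2) *:r 1).
Proof.
move=> n_gt0; rewrite -rscaleA.
have k0 : coef2 / (1 + t n) != 0.
  by rewrite mulf_neq0 ?invr_eq0 // lt0r_neq0 // powR_rhoD1_gt0.
have comm1E : ((1 - q ^- 2) / (1 + t 0)) *:r rad 0
    = if b then (1 - q^-1) *:r (x 0%N ^+ 2) else 0.
  rewrite powR_rho0 radius2_0; case: (b); rewrite ?rscaler0 //.
  congr (_ *:r _); field.
  by rewrite q_neq0 gt_eqF // addr_gt0.
split=> [h|[[xx sx] comm sE]].
  have comm : forall m, (m < n)%N -> commutator (x m.+1) (star (x m.+1))
      = ((1 - q ^- 2) / (1 + t m)) *:r rad m.
    case=> [_|m mn]; first by rewrite comm1E; apply: h; constructor.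
    exact: (h _ _ (Sphere_comm b q r x (i := m.+2) mn)).
  split; last 2 first.
  - exact/comm_radius.
  - rewrite sphere_sqr_radius; last exact/comm_radius.
    by congr (_ *:r _); apply: h; constructor.
  split=> i j ii ij ij'.
    exact: (h _ _ (Sphere_xx q r x ii ij ij')).
  exact: (h _ _ (Sphere_sx q r x ii ij ij')).
have radE := sphere_sqr_radius comm.
move/comm_radius: comm => comm.
move=> y z [i j|i j||[|[|i]]|] //.
- exact: xx.
- exact: sx.
- by rewrite -comm1E; apply: comm.
- by move=> /= i_n; apply: comm.
- by apply: (rscaleI k0); rewrite -radE.
Qed.

End Generators.

(** * Rescaling the generators *)

Section Rescale.
Variables (x : nat -> A) (c : R).
Hypothesis c_neq0 : c != 0.

Let c2_neq0 : c ^+ 2 != 0. Proof. by rewrite expf_neq0. Qed.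

Lemma sphere_sqr_rescale n :
  sphere_sqr q b (rescale c x) n = c ^+ 2 *:r sphere_sqr q b x n.
Proof.
elim: n => [|n IHn] /=.
  case: (b); rewrite ?rscaler0 // /rescale !expr2 rscaleAl rscaleAr !rscaleA.
  by congr rscale; ring.
rewrite IHn rscaleDr /rescale star_rscale rscaleAl rscaleAr !rscaleA.
by congr (_ + _); congr rscale; move: coef2 => d; ring.
Qed.

(** All relations are homogeneous of degree two in the generators and their adjoints, and [c] is
    real, so every term acquires the factor [c ^+ 2]. *)
Lemma clifford_rels_rescale n s :
  clifford_rels q b (rescale c x) n (c ^+ 2 *:r s) <-> clifford_rels q b x n s.
Proof.
have prodE (y z y' z' : A) :
    (c *:r y) * (c *:r z) = q *:r ((c *:r y') * (c *:r z')) <->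
    y * z = q *:r (y' * z').
  rewrite !rscaleAl !rscaleAr !rscaleA -!expr2 [q * _]mulrC -(rscaleA (c ^+ 2)).
  exact: rscale_eq.
have commE m : coef2 *:r commutator (rescale c x m.+1) (star (rescale c x m.+1))
      = (1 - q ^- 2) *:r sphere_sqr q b (rescale c x) m <->
    coef2 *:r commutator (x m.+1) (star (x m.+1))
      = (1 - q ^- 2) *:r sphere_sqr q b x m.
  rewrite sphere_sqr_rescale /commutator /rescale star_rscale.
  rewrite !rscaleAl !rscaleAr !rscaleA -expr2 -rscaleBr !rscaleA.
  rewrite ![_ * c ^+ 2]mulrC -!(rscaleA (c ^+ 2)).
  exact: rscale_eq.
rewrite /clifford_rels sphere_sqr_rescale.
split=> [[[xx sx] comm /(rscaleI c2_neq0) sE]|[[xx sx] comm ->]].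
  split=> //; last by move=> m mn; apply/commE/comm.
  split=> i j ii ij ltij; first by apply/prodE/xx.
  by apply/prodE; rewrite -star_rscale; apply: sx.
split=> //; last by move=> m mn; apply/commE/comm.
split=> i j ii ij ltij; first by apply/prodE/xx.
by rewrite /rescale star_rscale; apply/prodE/sx.
Qed.

End Rescale.

Lemma mscale_eq m c (M M' : 'M[A]_m) : c != 0 -> c *:m M = c *:m M' <-> M = M'.
Proof.
move=> c0; split=> [/matrixP e|->//]; apply/matrixP=> i j.
by have := e i j; rewrite !mxE => /(rscaleI c0).
Qed.

Lemma idempotent_symmetry m (u : 'M[A]_m) :
  idempotent_mx ((1 / 2) *:m (1%:M + u)) <-> u *m u = 1%:M.
Proof.
rewrite /idempotent_mx mscale_mulmx; set M := 1%:M + u.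
(* Both sides now carry the factor 1/4, and idempotency becomes [M *m M = M + M]. *)
have -> : (1 / 2) *:m M = (1 / 2 * (1 / 2)) *:m (M + M).
  apply/matrixP=> i j; rewrite [LHS]mxE [RHS]mxE.
  rewrite [(M + M) i j]mxE -{2 3}[M i j]rscale1 -rscaleDl rscaleA.
  by congr (_ *:r _); field.
have h0 : 1 / 2 * (1 / 2) != 0 :> R by apply: lt0r_neq0; lra.
rewrite (mscale_eq _ _ h0).
rewrite /M mulmxDl mul1mx mulmxDr mulmx1.
by split=> [/addrI|->]; rewrite [1%:M + u]addrC; [move/addrI|].
Qed.

Lemma hermitian_symmetry m (u : 'M[A]_m) :
  hermitian_mx u -> hermitian_mx ((1 / 2) *:m (1%:M + u)).
Proof.
move=> /matrixP hu; apply/matrixP=> i j.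
have := hu i j; rewrite !mxE star_rscale starD => ->; rewrite eq_sym.
by case: (_ == _); rewrite ?star1 ?star0.
Qed.

Lemma sphere_mx_herm (x : nat -> A) n : (b -> star (x 0%N) = x 0%N) ->
  hermitian_mx (sphere_mx q x b n).
Proof. by move=> hx; apply: hermitian_symmetry; apply: sphere_u_herm. Qed.

Lemma sphere_mx_idem (x : nat -> A) n : (b -> star (x 0%N) = x 0%N) ->
  idempotent_mx (sphere_mx q x b n) <-> clifford_rels q b x n 1.
Proof. by move=> hx; rewrite idempotent_symmetry sphere_u_sqr. Qed.

Lemma rescale_star (x : nat -> A) c :
  (b -> star (x 0%N) = x 0%N) -> b -> star (rescale c x 0%N) = rescale c x 0%N.
Proof. by move=> hx /hx e; rewrite /rescale star_rscale e. Qed.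

Lemma sphere_norm_gt0 n : 0 < (1 + t n) / coef2.
Proof. by rewrite divr_gt0 ?powR_rhoD1_gt0 ?coef2_gt0. Qed.

(** The scaling factor is chosen so that its square turns the constant [coef2 / (1 + t n) * r ^+ 2]
    into 1. *)
Lemma sphere_mx_rescale_idem (x : nat -> A) n r : r != 0 -> (0 < n)%N ->
  (b -> star (x 0%N) = x 0%N) ->
  idempotent_mx (sphere_mx q (rescale (sphere_norm q b n * r^-1) x) b n) <->
  rel_holds (sphere_rel b n q r x).
Proof.
move=> r0 n0 hx; rewrite sphere_mx_idem; last exact: rescale_star.
have N0 := sphere_norm_gt0 n.
have c0 : sphere_norm q b n * r^-1 != 0.
  by rewrite mulf_neq0 ?invr_eq0 // lt0r_neq0 // powR_gt0.
rewrite sphere_relsE // -(clifford_rels_rescale x c0) rscaleA.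
suff -> : (sphere_norm q b n / r) ^+ 2 * (coef2 / (1 + t n) * r ^+ 2) = 1.
  by rewrite rscale1.
rewrite exprMn sqr_powR_half // exprVn.
field; rewrite r0 lt0r_neq0 ?powR_rhoD1_gt0 // lt0r_neq0 ?coef2_gt0 //.
Qed.

(** At this radius the constant is already 1. Only [r ^+ 2] enters the relations, so either sign of
    [r] is allowed. *)
Lemma sphere_mx_idem_norm (x : nat -> A) n r : (0 < n)%N ->
  (b -> star (x 0%N) = x 0%N) -> r ^+ 2 = (1 + t n) / coef2 ->
  idempotent_mx (sphere_mx q x b n) <-> rel_holds (sphere_rel b n q r x).
Proof.
move=> n0 hx rE; rewrite sphere_mx_idem // sphere_relsE // rE -invf_div mulVf.
  by rewrite rscale1.
by rewrite lt0r_neq0 // sphere_norm_gt0.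
Qed.

End SphereRelations.

(** * Explicit matrices *)

Section LowDimensions.
Variables (R : realType) (q : R) (A : starAlgType R[i]).
Hypothesis q_gt0 : 0 < q.
Implicit Type x : nat -> A.

Local Notation a := ((1 + q) `^ (1 / 2)).

(* Indexed by natural numbers, so that concrete entries reduce. *)
Fixpoint sphere_entry (x : nat -> A) (b : bool) (n i j : nat) : A :=
  if n is m.+1 then
    let c := if b then a else 1 in
    if (i < 2 ^ m)%N then
      if (j < 2 ^ m)%N then q^-1 *:r sphere_entry x b m i j
      else if i == (j - 2 ^ m)%N then c *:r x m.+1 else 0
    else
      if (j < 2 ^ m)%N then
        if (i - 2 ^ m)%N == j then c *:r star (x m.+1) else 0
      else - sphere_entry x b m (i - 2 ^ m) (j - 2 ^ m)
  else if i == j then if b then q `^ (1 / 2) *:r x 0%N else 0 else 0.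

Lemma sphere_uE x b n (i j : 'I_(2 ^ n)) :
  sphere_u q x b n i j = sphere_entry x b n i j.
Proof.
elim: n i j => [|n IHn] i j /=; first by rewrite mxE -val_eqE; case: eqP.
rewrite castmxE /suspension.
set i' := cast_ord _ i; set j' := cast_ord _ j.
rewrite -[nat_of_ord i]/(nat_of_ord i') -[nat_of_ord j]/(nat_of_ord j').
case: (split_ordP i') => k ->; case: (split_ordP j') => l ->.
all: rewrite ?(block_mxEul, block_mxEur, block_mxEdl, block_mxEdr) mxE /=.
all: rewrite ?ltn_ord ?[(_ + _ < _)%N]ltnNge ?leq_addr /= ?addKn.
- by rewrite IHn.
- by rewrite -val_eqE; case: (_ == _).
- by rewrite -val_eqE; case: (_ == _).
- by rewrite IHn.
Qed.

Lemma sphere_mxE x b n (i j : 'I_(2 ^ n)) : sphere_mx q x b n i j =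
  (1 / 2) *:r ((i == j :> nat)%:R + sphere_entry x b n i j).
Proof. by rewrite !mxE sphere_uE. Qed.

(** The recursion produces factors [q^-1] on top of the base entry [q^(1/2) x_0], where the explicit
    matrices show a single fractional power. *)
Lemma powR_Nhalf : q `^ (- (1 / 2)) = q^-1 * q `^ (1 / 2).
Proof.
rewrite -[q^-1]powR_inv1 ?ltW // -powRD ?(gt_eqF q_gt0) ?implybT //.
by congr (_ `^ _); field.
Qed.

Lemma powR_N3half : q `^ (- (3 / 2)) = q^-1 * q^-1 * q `^ (1 / 2).
Proof.
rewrite -mulrA -powR_Nhalf -[q^-1]powR_inv1 ?ltW // -powRD.
  by congr (_ `^ _); field.
by rewrite (gt_eqF q_gt0) implybT.
Qed.

Lemma sphere_mx2E x r : sphere_mx q (rescale r^-1 x) true 1 = sphere2_mx q x r.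
Proof.
apply/matrixP => i j; rewrite sphere_mxE !mxE powR_Nhalf; congr rscale.
by case: i j => [[|[|//]] ?] [[|[|//]] ?] /=;
  rewrite /rescale ?star_rscale ?rscaleA ?add0r.
Qed.

Lemma sphere_mx3E x : sphere_mx q x false 2 = sphere3_mx q x.
Proof.
apply/matrixP => i j; rewrite sphere_mxE !mxE; congr rscale.
by case: i j => [[|[|[|[|//]]]] ?] [[|[|[|[|//]]]] ?] /=;
  rewrite ?rscaler0 ?oppr0 ?rscaler0 ?oppr0 ?addr0 ?add0r ?rscale1.
Qed.

Lemma sphere_mx4E x : sphere_mx q x true 2 = sphere4_mx q x.
Proof.
apply/matrixP => i j; rewrite sphere_mxE !mxE powR_Nhalf powR_N3half; congr rscale.
by case: i j => [[|[|[|[|//]]]] ?] [[|[|[|[|//]]]] ?] /=;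
  rewrite ?rscalerN ?rscaleA ?mulrA ?opprK ?rscaler0 ?oppr0 ?rscaler0 ?oppr0
          ?addr0 ?add0r ?rscale1.
Qed.

Lemma sphere_mx5E x : sphere_mx q x false 3 = sphere5_mx q x.
Proof.
(* Two suspensions yield [q^-1 * q^-1] where the explicit matrix has [q ^- 2]; the 64 entries are
   then compared one by one. *)
apply/matrixP => i j; rewrite sphere_mxE !mxE expr2 invfM; congr rscale.
case: i j => [[|[|[|[|[|[|[|[|//]]]]]]]] ?].
all: case=> [[|[|[|[|[|[|[|[|//]]]]]]]] ?] /=;
  by rewrite ?rscalerN ?rscale1 ?rscaleA ?mulrA ?opprK ?rscaler0 ?oppr0 ?rscaler0
    ?oppr0 ?rscaler0 ?oppr0 ?addr0 ?add0r ?rscale1.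
Qed.

Lemma symmetry_ofK m (u : 'M[A]_m) : symmetry_of ((1 / 2) *:m (1%:M + u)) = u.
Proof.
apply/matrixP => i j; rewrite !mxE rscaleA.
have -> : 2 * (1 / 2) = 1 :> R by field.
by rewrite rscale1 addrC addKr.
Qed.

Lemma rescale1 (x : nat -> A) : rescale 1 x = x.
Proof. by apply/funext => i; rewrite /rescale rscale1. Qed.

Lemma sphere_mxS x b n : sphere_mx q x b n.+1 =
  castmx (pow2D n, pow2D n) ((1 / 2) *:m block_mx
    (1%:M + q^-1 *:m sphere_u q x b n) ((if b then a else 1) *:r x n.+1)%:M
    ((if b then a else 1) *:r star (x n.+1))%:M (1%:M - sphere_u q x b n)).
Proof.
rewrite /sphere_mx /= /suspension.
case: _ / (pow2D n); rewrite !castmx_id scalar_mx_block add_block_mx.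
by rewrite !add0r.
Qed.

(** Taking radius 1 in [sphere2_mx] is what omitting the factor [r^-1] from u_(2) means. *)
Lemma sphere4_mx_block x (u := symmetry_of (sphere2_mx q x 1)) :
  sphere4_mx q x = (1 / 2) *:m block_mx (1%:M + q^-1 *:m u) (a *:r x 2%N)%:M
                                        (a *:r star (x 2%N))%:M (1%:M - u).
Proof.
have -> : u = sphere_u q x true 1.
  by rewrite /u -sphere_mx2E invr1 rescale1; apply: symmetry_ofK.
by rewrite -sphere_mx4E sphere_mxS castmx_id.
Qed.

Lemma sphere5_mx_block x (u := symmetry_of (sphere3_mx q x)) :
  sphere5_mx q x = (1 / 2) *:m block_mx (1%:M + q^-1 *:m u) (x 3%N)%:M
                                        (star (x 3%N))%:M (1%:M - u).
Proof.
have -> : u = sphere_u q x false 2.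
  by rewrite /u -sphere_mx3E; apply: symmetry_ofK.
by rewrite -sphere_mx5E sphere_mxS castmx_id !rscale1.
Qed.

End LowDimensions.

(** * The explicit lists of relations in low dimensions *)

Section LowDimensionalRelations.
Variables (R : realType) (q : R) (A : starAlgType R[i]) (x : nat -> A).
Hypothesis q_gt0 : 0 < q.

Local Notation x0 := (x 0%N).
Local Notation x1 := (x 1%N).
Local Notation x2 := (x 2%N).

Let q_neq0 : q != 0. Proof. by rewrite gt_eqF. Qed.
Let qD1_neq0 : 1 + q != 0. Proof. by rewrite lt0r_neq0 // addr_gt0. Qed.

(** This is the equation of the upper left block, the source of the second radius formula in each
    explicit list. *)
Lemma clifford_rels_dual b n s : clifford_rels q b x n.+1 s ->
  q ^- 2 *:r sphere_sqr q b x n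
  + (if b then 1 + q else 1) *:r (x n.+1 * star (x n.+1)) = s.
Proof. by case=> _ comm sE; apply/(sphere_sqr_dual sE); apply: comm. Qed.

(** Dropping the last generator leaves its partial square as the constant, so the upper left
    equation can be applied again one level down. *)
Lemma clifford_relsW b n s : clifford_rels q b x n.+1 s ->
  clifford_rels q b x n (sphere_sqr q b x n).
Proof.
by case=> /comm_relsS[xx _] comm _; split=> // m mn; apply: comm; apply: leqW.
Qed.

Let comm1E :
  (1 + q) *:r commutator x1 (star x1) = (1 - q ^- 2) *:r (q *:r x0 ^+ 2) <->
  commutator x1 (star x1) = (1 - q^-1) *:r x0 ^+ 2.
Proof.
rewrite rscaleA.
have -> : (1 - q ^- 2) * q = (1 + q) * (1 - q^-1) by field.
by rewrite -rscaleA; apply: rscale_eq.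
Qed.

Lemma sphere2_relsE r : star x0 = x0 ->
  sphere2_rels q x r <-> clifford_rels q true x 1 ((r ^+ 2) *:r 1).
Proof.
move=> hx; split=> [[h1 h2 comm sE _]|cliff].
  split; last by rewrite sE.
    apply/comm_relsS; split; first exact: comm_rels0.
    by case=> [_|//]; rewrite hx.
  by case=> //= _; apply/comm1E.
have dual := clifford_rels_dual cliff.
case: cliff => [/comm_relsS[_ /(_ 0%N isT)[h1 _ h2]] comm sE].
split=> //; first by apply/comm1E/(comm 0%N).
by rewrite -dual /= rscaleA; congr (_ *:r _ + _); field.
Qed.

Lemma sphere4_relsE : sphere4_rels q x <-> clifford_rels q true x 2 1.
Proof.
(* The partial square of level 1 is put into the mixed form that the listed commutator of [x2] and
   [star x2] uses. *)
have S1E : commutator x1 (star x1) = (1 - q^-1) *:r x0 ^+ 2 ->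
    q *:r x0 ^+ 2 + (1 + q) *:r (star x1 * x1)
    = q *:r (x1 * star x1) + x0 ^+ 2 + star x1 * x1.
  move=> /(canRL (subrK _))->; rewrite rscaleDr rscaleDl rscale1 rscaleA.
  rewrite mulrBr mulr1 divff // rscaleBl rscale1 -!addrA; congr (_ + _).
  by rewrite [RHS]addrCA addKr addrC.
have comm2E S : (1 + q) *:r commutator x2 (star x2) = (1 - q ^- 2) *:r S <->
    commutator x2 (star x2) = (q^-1 * (1 - q^-1)) *:r S.
  have -> : 1 - q ^- 2 = (1 + q) * (q^-1 * (1 - q^-1)) by field.
  by rewrite -rscaleA; apply: rscale_eq.
split=> [[xx comm1 comm2 sE _]|cliff].
  split=> //; last by rewrite sE /= addrC -addrA [_ + q *:r _]addrC.
  case=> [_|[_|//]] /=; first exact/comm1E.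
  by apply/comm2E; rewrite S1E.
have dual1 := clifford_rels_dual (clifford_relsW cliff).
have dual2 := clifford_rels_dual cliff.
case: cliff => [xx comm sE].
have comm1 : commutator x1 (star x1) = (1 - q^-1) *:r x0 ^+ 2.
  by apply/comm1E/(comm 0%N).
split=> //.
- by rewrite -S1E //; apply/comm2E/(comm 1%N).
- by rewrite -sE /= addrC -[RHS]addrA [_ *:r _ + q *:r _]addrC.
(* The upper left equation is used twice: for the whole, then for the partial square of level 1
   inside it. *)
- rewrite -{1}dual2 -dual1 addrC; congr (_ + _ *:r _); rewrite addrC rscaleA.
  by congr (_ + _ *:r _); field.
Qed.

Lemma sphere3_relsE : sphere3_rels q x <-> clifford_rels q false x 2 1.
Proof.
split=> [[xx /eqP]|cliff].
  rewrite subr_eq0 => /eqP PQ comm2 sE _.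
  split=> //; last by rewrite sE /= add0r !rscale1 addrC.
  case=> [_|[_|//]] /=; rewrite ?add0r !rscale1 ?rscaler0 //.
    by rewrite /commutator PQ subrr.
  by rewrite comm2 PQ.
have := clifford_rels_dual cliff.
case: cliff => [xx comm sE] /=.
have /= := comm 0%N isT; rewrite rscale1 rscaler0 => comm1.
have /= := comm 1%N isT; rewrite add0r !rscale1 => comm2 dual.
(* For even N, [x1] commutes with its adjoint, so the two orders of their product can be exchanged
   everywhere. *)
have /eqP := comm1; rewrite subr_eq0 => /eqP PQ; rewrite /sphere3_rels PQ.
split=> //; first by rewrite -sE /= add0r !rscale1 addrC.
by rewrite -{1}dual addrC.
Qed.

Lemma sphere5_relsE : sphere5_rels q x <-> clifford_rels q false x 3 1.
Proof.
split=> [[[xx /eqP]]|cliff].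
  rewrite subr_eq0 => /eqP PQ comm2 [comm3 _ sE _].
  split=> //; last first.
    by rewrite sE /= add0r !rscale1 addrC [star x1 * x1 + _]addrC addrA.
  case=> [_|[_|[_|//]]] /=; rewrite ?add0r !rscale1 ?rscaler0 //.
  - by rewrite /commutator PQ subrr.
  - by rewrite comm2 PQ.
  - by rewrite comm3 [star x2 * x2 + _]addrC.
have := clifford_rels_dual (clifford_relsW cliff).
have := clifford_rels_dual cliff.
case: cliff => [xx comm sE] /=.
have /= := comm 0%N isT; rewrite rscale1 rscaler0 => comm1.
have /= := comm 1%N isT; rewrite add0r !rscale1 => comm2.
have /= := comm 2%N isT; rewrite add0r !rscale1 => comm3 dual3 dual2.
have /eqP := comm1; rewrite subr_eq0 => /eqP PQ; rewrite /sphere5_rels PQ.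
split; split=> //.
- by rewrite comm3 [star x1 * x1 + _]addrC.
(* The second formula for this commutator is the first with the partial square of level 2 in its
   upper left form. *)
- by rewrite comm3 -dual2 [_ *:r _ + _]addrC.
- by rewrite -sE /= add0r !rscale1 addrC [star x1 * x1 + _]addrC addrA.
- by rewrite -{1}dual3 -dual2 addrC [X in _ *:r X]addrC.
Qed.

End LowDimensionalRelations.

(** * Ideals of the free *-algebra *)

Section SphereQuotient.
Variables (R : realType) (q : R) (b : bool) (n : nat) (A : starAlgType R[i]).
Variable rel : A -> A -> Prop.
Hypothesis rel_proper : ~ star_ideal rel 1.
Local Notation pi := (star_pi rel_proper).

Lemma star_pi_rscale (c : R) y : pi (c *:r y) = c *:r pi y.
Proof. exact: star_piZ. Qed.

Lemma star_pi_commutator y z : pi (commutator y z) = commutator (pi y) (pi z).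
Proof. by rewrite /commutator star_piD star_piN !star_piM. Qed.

Lemma star_pi_radius2 (x : nat -> A) i :
  pi (radius2 b q x i) = radius2 b q (pi \o x) i.
Proof.
rewrite /radius2 star_piD; congr (_ + _).
  rewrite (big_morph pi (star_piD rel_proper) (star_pi0 rel_proper)).
  by apply: eq_bigr => k _; rewrite star_piD star_pi_rscale !star_piM star_piS.
by case: (b); rewrite ?star_pi0 // !expr2 star_piM.
Qed.

(** The projection to the quotient is a *-morphism and carries each relation to the same relation
    between the images. Results valid in every *-algebra thereby become statements about ideals. *)
Lemma star_pi_sphere_rel (x : nat -> A) r :
  rel_holds (sphere_rel b n q r (pi \o x)) <->
  (forall y z, sphere_rel b n q r x y z -> star_ideal rel (y - z)).
Proof.
have radE c i : pi (c *:r radius2 b q x i) = c *:r radius2 b q (pi \o x) i.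
  by rewrite star_pi_rscale star_pi_radius2.
have comm1E : pi (if b then (1 - q^-1) *:r (x 0%N ^+ 2) else 0)
    = if b then (1 - q^-1) *:r ((pi \o x) 0%N ^+ 2) else 0.
  by case: (b); rewrite ?star_pi0 // star_pi_rscale !expr2 star_piM.
split=> [h y z yz|h y z].
  apply/star_piP; case: yz => [i j ii ij ltij|i j ii ij neij||i i_n|].
  - by rewrite star_pi_rscale !star_piM; apply: h; apply: Sphere_xx.
  - by rewrite star_pi_rscale !star_piM star_piS; apply: h; apply: Sphere_sx.
  - by rewrite star_pi_commutator star_piS comm1E; apply: h; apply: Sphere_comm1.
  - by rewrite star_pi_commutator star_piS radE; apply: h; apply: Sphere_comm.
  - by rewrite star_pi_rscale star_pi_radius2; apply: h; apply: Sphere_radius.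
case=> [i j ii ij ltij|i j ii ij neij||i i_n|].
- have /(star_piP rel_proper) := h _ _ (Sphere_xx q r x ii ij ltij).
  by rewrite star_pi_rscale !star_piM.
- have /(star_piP rel_proper) := h _ _ (Sphere_sx q r x ii ij neij).
  by rewrite star_pi_rscale !star_piM star_piS.
- have /(star_piP rel_proper) := h _ _ (Sphere_comm1 b n q r x).
  by rewrite star_pi_commutator star_piS comm1E.
- have /(star_piP rel_proper) := h _ _ (Sphere_comm b q r x i_n).
  by rewrite star_pi_commutator star_piS radE.
- have /(star_piP rel_proper) := h _ _ (Sphere_radius b n q r x).
  by rewrite star_pi_rscale star_pi_radius2.
Qed.

Lemma star_pi_mx (x : nat -> A) :
  map_mx pi (sphere_mx q x b n) = sphere_mx q (pi \o x) b n.
Proof.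
apply/matrixP => i j; rewrite mxE !sphere_mxE star_pi_rscale star_piD.
congr (_ *:r (_ + _)); first by case: (_ == _); rewrite ?star_pi0.
elim: n (nat_of_ord i) (nat_of_ord j) => [|m IHm] {}i {}j /=.
  by case: ifP => _; case: (b); rewrite ?star_pi0 ?star_pi_rscale.
case: ifP => _; case: ifP => _.
- by rewrite star_pi_rscale IHm.
- by case: ifP => _; rewrite ?star_pi0 ?star_pi_rscale.
- by case: ifP => _; rewrite ?star_pi0 // star_pi_rscale star_piS.
- by rewrite star_piN IHm.
Qed.

Lemma star_pi_idempotent m (e : 'M[A]_m) :
  idempotent_mx (map_mx pi e) <->
  (forall i j, star_ideal rel ((e *m e) i j - e i j)).
Proof.
have mulE : map_mx pi e *m map_mx pi e = map_mx pi (e *m e).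
  apply/matrixP => i j; rewrite !mxE.
  rewrite (big_morph pi (star_piD rel_proper) (star_pi0 rel_proper)).
  by apply: eq_bigr => k _; rewrite !mxE star_piM.
rewrite /idempotent_mx mulE; split=> [/matrixP h i j|h].
  by apply/(star_piP rel_proper); have := h i j; rewrite mxE [RHS]mxE.
by apply/matrixP => i j; rewrite mxE [RHS]mxE; apply/star_piP.
Qed.

Lemma star_pi_hermitian m (e : 'M[A]_m) :
  hermitian_mx e -> hermitian_mx (map_mx pi e).
Proof.
move=> /matrixP h; apply/matrixP => i j.
by have := h i j; rewrite !mxE -star_piS => ->.
Qed.

End SphereQuotient.

Section StarIdeals.
Variables (C : numClosedFieldType) (A : starAlgType C).
Implicit Types rel : A -> A -> Prop.

Lemma star_ideal_rel rel y z : rel y z -> star_ideal rel (y - z).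
Proof. by move=> yz I _; apply. Qed.

Lemma star_ideal_sub rel rel' :
  (forall y z, rel y z -> star_ideal rel' (y - z)) ->
  (star_ideal rel `<=` star_ideal rel')%classic.
Proof. by move=> h y; apply=> //; apply: star_idealP. Qed.

Lemma star_ideal1 rel y : star_ideal rel 1 -> star_ideal rel y.
Proof.
move=> h; have [_ _ hM _] := star_idealP rel.
by rewrite -[y]mulr1 -[y * 1]mulr1; exact: hM.
Qed.

Lemma star_ideal0 rel : star_ideal rel 0.
Proof. by case: (star_idealP rel). Qed.

End StarIdeals.

(** * Equality of the two ideals of relations *)

Section ProjectionIdeal.
Variables (R : realType) (q r : R) (b : bool) (n : nat) (A : starAlgType R[i]).
Variable x : nat -> A.
Hypotheses (q_gt0 : 0 < q) (r_neq0 : r != 0) (n_gt0 : (0 < n)%N).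
Hypothesis x0_star : b -> star (x 0%N) = x 0%N.
Let e := sphere_mx q (rescale (sphere_norm q b n * r^-1) x) b n.

(** The equivalence between idempotency and the sphere relations is applied in the quotient by
    [rel], where equality means membership in the ideal. *)
Lemma sphere_mx_ideal (rel : A -> A -> Prop) :
  (forall i j, star_ideal rel ((e *m e) i j - e i j)) <->
  (forall y z, sphere_rel b n q r x y z -> star_ideal rel (y - z)).
Proof.
(* The quotient is formed only for a proper ideal; an ideal containing 1 contains everything, and
   both sides hold. *)
have [rel1|rel_proper] := pselect (star_ideal rel 1).
  by split=> *; apply: star_ideal1.
rewrite -(star_pi_idempotent rel_proper) -(star_pi_sphere_rel _ _ _ rel_proper).
rewrite star_pi_mx.
have -> : star_pi rel_proper \o rescale (sphere_norm q b n * r^-1) x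
    = rescale (sphere_norm q b n * r^-1) (star_pi rel_proper \o x).
  by apply/funext => i; apply: star_pi_rscale.
apply: sphere_mx_rescale_idem => // hb.
by rewrite /= -star_piS x0_star.
Qed.

(** Each inclusion takes one of the two sets of relations as [rel] in [sphere_mx_ideal]. The
    hermitian relations contribute only 0, since [e] is hermitian before any quotient is taken. *)
Lemma projection_ideal :
  star_ideal (projection_rel e) = star_ideal (sphere_rel b n q r x).
Proof.
have herm : hermitian_mx e by apply: sphere_mx_herm; apply: rescale_star.
apply/seteqP; split; apply: star_ideal_sub.
  move=> _ _ [i j|i j]; last by rewrite herm subrr; apply: star_ideal0.
  by apply: (proj2 (sphere_mx_ideal _)) => y z; apply: star_ideal_rel.
apply: (proj1 (sphere_mx_ideal _)) => i j.
by apply: star_ideal_rel; apply: Projection_idempotent.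
Qed.

End ProjectionIdeal.

Lemma free_gen0_star (R : realType) b n :
  star (free_gen R b n 0) = free_gen R b n 0.
Proof.
(* When [b] is false, the generator of index 0 is the default value 0. *)
rewrite /free_gen; case: insubP => [o _ _|_]; last exact: star0.
apply: etrans (fstarU _ _) _; rewrite conjC1; congr << _ >>.
by apply: val_inj; rewrite /= !fmU.
Qed.

Lemma sphere_projection (R : realType) (q r : R) b n (n_gt0 : (0 < n)%N) :
  0 < q -> r != 0 ->
  exists e : 'M[free_star R b n]_(2 ^ n),
    is_projection (map_mx (to_qsphere q r n_gt0) e) /\
    star_ideal (projection_rel e)
      = star_ideal (sphere_rel b n q r (free_gen R b n)).
Proof.
move=> q_gt0 r_neq0.
have x0_star := fun _ : b => free_gen0_star R b n.
exists (sphere_mx q (rescale (sphere_norm q b n * r^-1) (free_gen R b n)) b n).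
split; last exact: projection_ideal.
split.
  apply/star_pi_idempotent/sphere_mx_ideal => // y z.
  exact: star_ideal_rel.
by apply: star_pi_hermitian; apply: sphere_mx_herm; apply: rescale_star.
Qed.

(** * Closed forms of the normalization and the assembled statement *)

Lemma powR_rho_odd (R : realType) (q : R) n : 0 < q ->
  q `^ (- 2 * rho true n.+1) = q ^+ (n.*2.+1).
Proof.
move=> q_gt0; elim: n => [|n IHn]; last by rewrite powR_rhoS // IHn -exprD doubleS.
by rewrite powR_rhoS // powR_rho0 // expr2 mulfK // gt_eqF.
Qed.

Lemma powR_rho_even (R : realType) (q : R) n : 0 < q ->
  q `^ (- 2 * rho false n.+1) = q ^+ n.*2.
Proof.
move=> q_gt0; elim: n => [|n IHn]; last by rewrite powR_rhoS // IHn -exprD doubleS.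
by rewrite powR_rhoS // powR_rho0 // divff // expf_neq0 // gt_eqF.
Qed.

Theorem mainTheorem1 (R : realType) (q r : R) (q_gt0 : 0 < q) (r_neq0 : r != 0) :
  [/\
    (* a projection over the sphere whose projection relations generate, in
       the free *-algebra, the same *-ideal as the relations of the sphere *)
    forall (b : bool) (n : nat) (n_gt0 : (0 < n)%N),
      exists e : 'M[free_star R b n]_(2 ^ n),
        is_projection (map_mx (to_qsphere q r n_gt0) e) /\
        star_ideal (projection_rel e)
          = star_ideal (sphere_rel b n q r (free_gen R b n)),
    (* N = 3 and N = 5 *)
    forall (A : starAlgType R[i]) (x : nat -> A), star (x 0%N) = x 0%N ->
      let a := (1 + q) `^ (1 / 2) in
      let u2 := symmetry_of (sphere2_mx q x 1) in
      [/\ [/\ hermitian_mx (sphere2_mx q x r),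
              idempotent_mx (sphere2_mx q x r) <-> sphere2_rels q x r &
              sphere2_rels q x r <-> rel_holds (sphere_rel true 1 q r x)],
          [/\ hermitian_mx (sphere4_mx q x),
              idempotent_mx (sphere4_mx q x) <-> sphere4_rels q x &
              forall r0 : R, r0 ^+ 2 = (1 + q ^+ 3) / (1 + q) ->
                sphere4_rels q x <-> rel_holds (sphere_rel true 2 q r0 x)],
          (let y := rescale (((1 + q ^+ 3) / (1 + q)) `^ (1 / 2) * r^-1) x in
           hermitian_mx (sphere4_mx q y) /\
           (idempotent_mx (sphere4_mx q y) <-> rel_holds (sphere_rel true 2 q r x))) &
          sphere4_mx q x
            = (1 / 2) *:m block_mx (1%:M + q^-1 *:m u2) (a *:r x 2%N)%:M
                                   (a *:r star (x 2%N))%:M (1%:M - u2)],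
    (* N = 4 and N = 6 *)
    forall (A : starAlgType R[i]) (x : nat -> A),
      let u3 := symmetry_of (sphere3_mx q x) in
      [/\ [/\ hermitian_mx (sphere3_mx q x),
              idempotent_mx (sphere3_mx q x) <-> sphere3_rels q x &
              forall r0 : R, r0 ^+ 2 = 1 + q ^+ 2 ->
                sphere3_rels q x <-> rel_holds (sphere_rel false 2 q r0 x)],
          [/\ hermitian_mx (sphere5_mx q x),
              idempotent_mx (sphere5_mx q x) <-> sphere5_rels q x &
              forall r0 : R, r0 ^+ 2 = 1 + q ^+ 4 ->
                sphere5_rels q x <-> rel_holds (sphere_rel false 3 q r0 x)],
          (let y := rescale ((1 + q ^+ 2) `^ (1 / 2) * r^-1) x in
           hermitian_mx (sphere3_mx q y) /\
           (idempotent_mx (sphere3_mx q y) <-> rel_holds (sphere_rel false 2 q r x))),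
          (let y := rescale ((1 + q ^+ 4) `^ (1 / 2) * r^-1) x in
           hermitian_mx (sphere5_mx q y) /\
           (idempotent_mx (sphere5_mx q y) <-> rel_holds (sphere_rel false 3 q r x))) &
          sphere5_mx q x
            = (1 / 2) *:m block_mx (1%:M + q^-1 *:m u3) (x 3%N)%:M
                                   (star (x 3%N))%:M (1%:M - u3)] &
    (* the inductive construction: its first cases, and all dimensions *)
    forall (A : starAlgType R[i]) (x : nat -> A),
      [/\ sphere_mx q (rescale r^-1 x) true 1 = sphere2_mx q x r,
          sphere_mx q x false 2 = sphere3_mx q x,
          sphere_mx q x true 2 = sphere4_mx q x,
          sphere_mx q x false 3 = sphere5_mx q x &
          forall (b : bool) (n : nat), (0 < n)%N ->
            (b -> star (x 0%N) = x 0%N) ->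
            let e := sphere_mx q (rescale (sphere_norm q b n * r^-1) x) b n in
            hermitian_mx e /\ (idempotent_mx e <-> rel_holds (sphere_rel b n q r x))]].
Proof.
have norm_odd n : sphere_norm q true n.+1 =
    ((1 + q ^+ n.*2.+1) / (1 + q)) `^ (1 / 2) by rewrite /sphere_norm powR_rho_odd.
have norm_even n : sphere_norm q false n.+1 = (1 + q ^+ n.*2) `^ (1 / 2).
  by rewrite /sphere_norm powR_rho_even // divr1.
split.
- by move=> b n n_gt0; apply: sphere_projection.
- move=> A x x0_star a u2.
  have hx : true -> star (x 0%N) = x 0%N by [].
  have rx c : true -> star (rescale c x 0%N) = rescale c x 0%N.
    exact: rescale_star.
  have rels2E : sphere2_rels q x r <-> rel_holds (sphere_rel true 1 q r x).
    (* For N = 3 the power of [q] is [q] itself, so the quotient [(1 + q) / (1 + q)] is 1 and the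
       constant is [r ^+ 2] for every radius. *)
    rewrite sphere_relsE // (powR_rho_odd 0) // divff.
      by rewrite mul1r sphere2_relsE.
    by rewrite lt0r_neq0 // addr_gt0.
  split; last exact: sphere4_mx_block.
  + rewrite -sphere_mx2E //; split=> //; first exact: (sphere_mx_herm q 1 (rx _)).
    rewrite rels2E -(sphere_mx_rescale_idem (b := true) q_gt0 (n := 1)) // norm_odd.
    rewrite divff ?powR1 ?mul1r //.
    by rewrite lt0r_neq0 // addr_gt0.
  + rewrite -sphere_mx4E //.
    split; first exact: (sphere_mx_herm q 2 hx).
      by rewrite (sphere_mx_idem q_gt0 2) // sphere4_relsE.
    move=> r0 r0E; rewrite sphere4_relsE // -(sphere_mx_idem q_gt0 2) //.
    by apply: (sphere_mx_idem_norm q_gt0 (n := 2)) => //; rewrite (powR_rho_odd 1).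
  + move=> y; rewrite {}/y -sphere_mx4E //.
    split; first exact: (sphere_mx_herm q 2 (rx _)).
    by rewrite -(norm_odd 1%N); apply: (sphere_mx_rescale_idem q_gt0 (n := 2)).
- move=> A x u3.
  (* For even N the self-adjointness of the generator of index 0 is a vacuous condition. *)
  have hx (y : nat -> A) : false -> star (y 0%N) = y 0%N by [].
  split; last exact: sphere5_mx_block.
  + rewrite -sphere_mx3E //.
    split; first exact: (sphere_mx_herm q 2 (hx _)).
      by rewrite (sphere_mx_idem q_gt0 2) // sphere3_relsE.
    move=> r0 r0E; rewrite sphere3_relsE // -(sphere_mx_idem q_gt0 2) //.
    apply: (sphere_mx_idem_norm q_gt0 (n := 2)) => //.
    by rewrite (powR_rho_even 1) // divr1.
  + rewrite -sphere_mx5E //.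
    split; first exact: (sphere_mx_herm q 3 (hx _)).
      by rewrite (sphere_mx_idem q_gt0 3) // sphere5_relsE.
    move=> r0 r0E; rewrite sphere5_relsE // -(sphere_mx_idem q_gt0 3) //.
    apply: (sphere_mx_idem_norm q_gt0 (n := 3)) => //.
    by rewrite (powR_rho_even 2) // divr1.
  + move=> y; rewrite {}/y -sphere_mx3E //.
    split; first exact: (sphere_mx_herm q 2 (hx _)).
    by rewrite -(norm_even 1%N); apply: (sphere_mx_rescale_idem q_gt0 (n := 2)).
  + move=> y; rewrite {}/y -sphere_mx5E //.
    split; first exact: (sphere_mx_herm q 3 (hx _)).
    by rewrite -(norm_even 2%N); apply: (sphere_mx_rescale_idem q_gt0 (n := 3)).
- move=> A x; split.
  + exact: sphere_mx2E.
  + exact: sphere_mx3E.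
  + exact: sphere_mx4E.
  + exact: sphere_mx5E.
  + move=> b n n_gt0 x0_star; split; last exact: sphere_mx_rescale_idem.
    by apply: sphere_mx_herm; apply: rescale_star.
Qed.
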